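(* Let $\sigma,\kappa>0$ and $\kappa_c:=4\sigma^4$. If $\kappa>\kappa_c$, then there exist infinitely many (non-constant) time-periodic ergodic Nash equilibria rotating around the uniform distribution; that is, infinitely many ergodic Nash equilibria $q(\cdot)$ that are the second component of a non-constant periodic solution $(a,q)$ of $$\dot a=2\sigma^2a+\tfrac12\,\mathrm{sign}(a)a^2-\kappa q,\qquad \dot q=a-(2\sigma^2+|a|)q$$ whose closed orbit in the $(a,q)$-plane encloses the origin $(0,0)$.
   Context: Let $\mathcal{X}=\{0,1\}$. The running cost is $\ell(0,p)=p$, $\ell(1,p)=1-p$ for $p\in[0,1]$. A probability measure on $\mathcal{X}$ is identified with the mass $p$ it gives to $1$, and $q=2p-1\in[-1,1]$; a flow $q(\cdot)$ is called a Nash equilibrium if $p(\cdot)=(q(\cdot)+1)/2$ is one. The uniform distribution is $q=0$. $\mathcal{A}$ is the set of functions $\alpha:[0,\infty)\times\mathcal{X}\to[0,\infty)$ with $\alpha(\cdot,x)$ locally integrable. For a flow $p:[0,\infty)\to[0,1]$ and $\alpha\in\mathcal{A}$, $X^{\alpha}$ is the continuous-time Markov chain on $\mathcal{X}$ with jump rate $\sigma^2+\alpha(t,0)$ from $0$ to $1$, jump rate $\sigma^2+\alpha(t,1)$ from $1$ to $0$, and $\mathbb{P}(X^{\alpha}_0=1)=p(0)$, and $$J_0(\alpha)=\limsup_{T\uparrow\infty}\frac1T\mathbb{E}\int_0^T\big(\tfrac12\alpha(t,X^{\alpha}_t)^2+\kappa\ell(X^{\alpha}_t,p(t))\big)dt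 .$$ A periodic or constant flow $p$ is an ergodic mean-field game Nash equilibrium if there is $\alpha^*\in\mathcal{A}$ minimizing $J_0$ over $\mathcal{A}$ with $p(t)=\mathbb{P}(X^{\alpha^*}_t=1)$ for all $t\ge0$. *)

(* Defs.v *)
From HB Require Import structures.
From mathcomp Require Export all_boot all_order all_algebra.
From mathcomp Require Export all_classical all_reals all_analysis.

Set Implicit Arguments.
Unset Strict Implicit.
Unset Printing Implicit Defensive.

Export Order.TTheory GRing.Theory Num.Theory.
Export numFieldNormedType.Exports.

Local Open Scope classical_set_scope.
Local Open Scope ring_scope.

(* The state space {0,1} is [bool], with [true] for 1 and [false] for 0.
   Functions of time have type [R -> _]; flows, controls, rates and processes
   are only constrained, and only used, at times t >= 0. *)

Section markov_chain.
Context {R : realType}.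
Implicit Types (rate : R -> bool -> R) (Pr : R -> R -> bool -> bool -> R).

(* [rate t x] is the rate of the jump from x to ~~ x at time t. *)
Definition generator rate (t : R) (x y : bool) : R :=
  if x == y then - rate t x else rate t x.

(* [Pr s t x y] is the probability to go from x at time s to y at time t.  The
   forward equation is in integrated form because rates are merely locally
   integrable in time; the first three fields make the integrand integrable. *)
Record transition_function rate Pr : Prop := {
  transition_ge0 : forall s t x y, 0 <= s -> s <= t -> 0 <= Pr s t x y;
  transition_sum1 : forall s t x, 0 <= s -> s <= t ->
    \sum_(y : bool) Pr s t x y = 1;
  transition_continuous : forall s x y, 0 <= s ->
    {within `[s, +oo[, continuous (fun t => Pr s t x y)};
  transition_forward : forall s t x y, 0 <= s -> s <= t ->
    Pr s t x y = (x == y)%:R +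
      \int[lebesgue_measure]_(u in `[s, t])
        (\sum_(z : bool) Pr s u x z * generator rate u z y) }.

(* [past] is a finite list of (time, state) pairs. *)
Definition cylinder {T : Type} (X : R -> T -> bool) (past : seq (R * bool)) :
  set T := [set w | forall c, c \in past -> X c.1 w = c.2].

Record markov_chain {d : measure_display} {T : measurableType d}
    (P : probability T R) (X : R -> T -> bool) rate (p0 : R) : Prop := {
  chain_measurable : forall t, 0 <= t -> measurable_fun setT (X t);
  chain_right_continuous : forall w t, 0 <= t ->
    \forall s \near t^'+, X s w = X t w;
  chain_left_limit : forall w t, 0 < t ->
    exists x, \forall s \near t^'-, X s w = x;
  chain_initial : P [set w | X 0 w = true] = p0%:E;
  chain_markov : exists2 Pr, transition_function rate Pr &
    forall (past : seq (R * bool)) (s t : R) (x y : bool),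
      0 <= s -> s <= t -> (forall c, c \in past -> 0 <= c.1 <= s) ->
      P (cylinder X (rcons (rcons past (s, x)) (t, y))) =
        (P (cylinder X (rcons past (s, x))) * (Pr s t x y)%:E)%E }.

End markov_chain.

Section game.
Context {R : realType}.
Implicit Types (p : R -> R) (alpha : R -> bool -> R).

Definition running_cost (x : bool) (p : R) : R := if x then 1 - p else p.

Definition admissible alpha : Prop :=
  (forall t x, 0 <= t -> 0 <= alpha t x) /\
  (forall T x, 0 <= T ->
     lebesgue_measure.-integrable `[0, T] (EFin \o (alpha^~ x))).

Definition controlled_chain (sigma : R) p alpha {d : measure_display}
    {T : measurableType d} (P : probability T R) (X : R -> T -> bool) : Prop :=
  markov_chain P X (fun t x => sigma ^+ 2 + alpha t x) (p 0).

(* J_0(alpha), computed on a realization X of the controlled chain.  Its value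
   may be +oo since alpha need not be square integrable. *)
Definition ergodic_cost (kappa : R) p alpha {d : measure_display}
    {T : measurableType d} (P : probability T R) (X : R -> T -> bool) : \bar R :=
  limf_esup (fun S : R =>
    (S^-1%:E * \int[P]_w \int[lebesgue_measure]_(t in `[0%R, S])
       (2^-1 * alpha t (X t w) ^+ 2 + kappa * running_cost (X t w) (p t))%:E)%E)
    (pinfty_nbhs R).

Definition periodic_flow p : Prop :=
  exists2 tau, 0 < tau & forall t, 0 <= t -> p (t + tau) = p t.

Definition constant_flow p : Prop := forall t, 0 <= t -> p t = p 0.

(* J_0(beta) depends only on beta, not on the probability space carrying the
   chain: minimality is therefore asked against every realization. *)
Definition ergodic_nash (sigma kappa : R) p : Prop :=
  [/\ forall t, 0 <= t -> 0 <= p t <= 1,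
      periodic_flow p \/ constant_flow p &
      exists (alpha : R -> bool -> R) (d : measure_display)
             (T : measurableType d) (P : probability T R) (X : R -> T -> bool),
        [/\ admissible alpha,
            controlled_chain sigma p alpha P X,
            forall t, 0 <= t -> P [set w | X t w = true] = (p t)%:E &
            forall (beta : R -> bool -> R) (d' : measure_display)
                   (T' : measurableType d') (P' : probability T' R)
                   (Y : R -> T' -> bool),
              admissible beta -> controlled_chain sigma p beta P' Y ->
              (ergodic_cost kappa p alpha P X <=
                 ergodic_cost kappa p beta P' Y)%E]].

Definition ergodic_nash_q (sigma kappa : R) (q : R -> R) : Prop :=
  ergodic_nash sigma kappa (fun t => (q t + 1) / 2).

End game.

Section orbits.
Context {R : realType}.
Implicit Types (a q : R -> R).

(* A periodic solution is taken on the whole line, where it extends uniquely. *)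
Definition solves_system (sigma kappa : R) a q : Prop := forall t : R,
  is_derive t 1 a (2 * sigma ^+ 2 * a t + 2^-1 * Num.sg (a t) * a t ^+ 2
                   - kappa * q t) /\
  is_derive t 1 q (a t - (2 * sigma ^+ 2 + `|a t|) * q t).

Definition periodic_pair a q : Prop :=
  exists2 tau, 0 < tau & forall t, a (t + tau) = a t /\ q (t + tau) = q t.

Definition orbit a q : set (R * R) := range (fun t => (a t, q t)).

(* z lies off C, in a bounded component of the complement of C. *)
Definition encloses (C : set (R * R)) (z : R * R) : Prop :=
  ~ C z /\ bounded_set (connected_component (~` C) z).

Definition rotating_equilibrium (sigma kappa : R) a q : Prop :=
  [/\ ergodic_nash_q sigma kappa q,
      exists s t, 0 <= s /\ 0 <= t /\ q s <> q t,
      solves_system sigma kappa a q,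
      periodic_pair a q &
      encloses (orbit a q) (0, 0)].

(* The system is autonomous, so all time shifts of one equilibrium follow the
   same orbit; they are not to be counted as different equilibria. *)
Definition time_translate (q1 q2 : R -> R) : Prop :=
  exists s, forall t, 0 <= t -> q1 t = q2 (t + s).

Definition kappa_c (sigma : R) : R := 4 * sigma ^+ 4.

End orbits.

(* Main.v *)
Require Import Defs.
From mathcomp Require Import measurable_realfun ring lra.

(** Write s = sigma^2, K = sqrt kappa and g(a) = 2 s a + sign(a) a^2 / 2. The
    system is Hamiltonian. In the variables a and v = kappa q - g(a) it reads
    a' = - v, so that a solves Newton's equation in the even potential
    (kappa a^2 - g(a)^2) / 2. The condition kappa > 4 sigma^4 says that 0 is a
    nondegenerate minimum of this potential, and each small level set of the
    energy is then a periodic orbit around the origin (closed_orbit): with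
    the signed square root of the potential as a coordinate, the level set
    is a circle on which the angle moves at a positive speed that depends on
    the angle only. There is one orbit for each small value of the energy.
    Along an orbit |q| < 1, so q and q' determine a and therefore the energy,
    and two flows q with different energies are not time translates.

    Each orbit is an equilibrium because the first equation of the system is
    the Hamilton-Jacobi equation of the control problem: - a is the difference
    of the values of the two states, and the optimal extra rates are the
    positive part of a in the state 0 and its negative part in the state 1.
    Under this control the second equation is the Kolmogorov equation for
    q = 2 p - 1. For an arbitrary control, let M(t) be the probability of the
    state 1. The expected cost rate is at least a function of time common to
    all controls plus the derivative of a M, with equality for the optimal
    control (hamiltonian_le, hamiltonian_best). Since a M is bounded, the
    costs over [0, S] compare up to a constant, which disappears in the
    average (best_cost_le). This needs the cost as an integral over time
    (expected_occupation) and an integration by parts in which M is only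
    absolutely continuous (integration_by_parts_ac).

    The optimally controlled chain also has to exist, with right-continuous
    paths. Its transition probabilities are explicit, since p solves the same
    linear equation as they do. The joint laws of the chain at countably many
    times form a consistent family of weights on finite binary words, which
    is realized by splitting the unit interval (binary_process,
    markov_skeleton). The expected number of jumps along dyadic grids of a
    bounded interval is bounded, so almost every path has limits from the
    right and from the left (few_jumps_right, few_jumps_left, regular_ae), and
    the limits from the right form the chain (markov_chain_exists). *)

Set Implicit Arguments.
Unset Strict Implicit.
Unset Printing Implicit Defensive.
Local Open Scope classical_set_scope.
Local Open Scope ring_scope.

(** * Antiderivatives and inverses of increasing functions *)

Lemma is_derive_continuous (R : realType) (f : R -> R) (x l : R) :
  is_derive x 1 f l -> {for x, continuous f}.
Proof. by case=> df _; apply/differentiable_continuous/derivable1_diffP. Qed.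

(** Integrating from 0 in both directions covers all signs of the argument.
    Near a given point the result differs by a constant from an integral
    with a fixed left endpoint, to which the fundamental theorem of calculus
    applies. *)
Lemma antiderivative (R : realType) (f : R -> R) : continuous f ->
  exists2 F : R -> R, F 0 = 0 & forall x : R, is_derive x 1 F (f x).
Proof.
move=> cf.
pose mu := @lebesgue_measure R.
have fi a b : mu.-integrable `[a, b] (EFin \o f).
  apply: continuous_compact_integrable; first exact: segment_compact.
  by apply: continuous_subspaceT.
have foi a b : mu.-integrable `]a, b] (EFin \o f).
  by apply: integrableS (fi a b) => //; exact: subset_itv_oc_cc.
pose F (y : R) := \int[mu]_(t in `[0, y]) f t - \int[mu]_(t in `[y, 0]) f t.
exists F; first by rewrite /F subrr.
move=> x.
pose M : R := `|x| + 1.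
pose G (y : R) := \int[mu]_(t in `[- M, y]) f t.
have M0 : 0 < M by rewrite ltr_wpDl.
have xM : x < M by rewrite (le_lt_trans (ler_norm _))// ltrDl.
have Mx : - M < x by rewrite ltrNl (le_lt_trans (ler_norm _))// normrN ltrDl.
have FG (y : R) : y \in `]- M, M[ -> F y = G y - G 0.
  rewrite in_itv/= => /andP[My yM]; rewrite /F /G.
  have [y0|y0] := leP 0 y.
    rewrite (_ : \int[mu]_(t in `[y, 0]) f t = 0); last first.
      move: y0; rewrite le_eqVlt => /predU1P[<-|y0].
        by rewrite set_itv1 Rintegral_set1.
      by rewrite set_itv_ge ?Rintegral_set0// bnd_simp -ltNge.
    rewrite subr0 Rintegral_itvB//.
    - by rewrite Rintegral_itv_obnd_cbnd.
    - by rewrite bnd_simp ltW// oppr_lt0.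
  rewrite (_ : \int[mu]_(t in `[0, y]) f t = 0); last first.
    by rewrite set_itv_ge ?Rintegral_set0// bnd_simp -ltNge.
  rewrite sub0r -opprB; congr (- _); rewrite Rintegral_itvB//.
  - by rewrite Rintegral_itv_obnd_cbnd.
  - by rewrite bnd_simp ltW.
  - by rewrite bnd_simp ltW.
have [dG GE] := @continuous_FTC1 _ f (BLeft (- M)) x M xM (fi _ _) Mx (cf x).
have Gx : is_derive x 1 (G : R^o -> R^o) (f x).
  by apply: DeriveDef; [exact: dG|rewrite -derive1E; exact: GE].
have := is_deriveB Gx (is_derive_cst (G 0 : R^o) x 1); rewrite subr0.
apply: (@near_eq_is_derive R R^o R^o _ F).
near=> y; apply/esym/FG; near: y.
by apply: near_in_itvoo; rewrite in_itv/= xM Mx.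
Unshelve. all: by end_near. Qed.

Lemma increasing_bijection (R : realType) (f : R -> R) :
  continuous f -> {homo f : x y / x < y} ->
  (forall y, exists u v, f u <= y <= f v) ->
  exists2 g : R -> R, cancel f g & cancel g f.
Proof.
move=> cf fi fs.
have fm : {mono f : x y / x < y} by exact: leW_mono (le_mono fi).
have finj : injective f by exact: inc_inj (le_mono fi).
have surj y : exists x, f x = y.
  have [u [v /andP[fu fv]]] := fs y.
  have uv : u <= v by rewrite -(le_mono fi) (le_trans fu).
  have [|x _ <-] := @IVT R f u v y uv (continuous_subspaceT cf).
    by rewrite ge_min fu /= le_max fv orbT.
  by exists x.
pose g y := projT1 (cid (surj y)).
have gK : cancel g f by move=> y; rewrite /g; case: cid.
by exists g => // x; apply: finj; rewrite gK.
Qed.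

(** * Derivatives of real functions *)

Section real_derivatives.
Context {R : realType}.
Implicit Types (f g : R -> R) (x a b : R).

Lemma derive_add f g x a b : is_derive x 1 f a -> is_derive x 1 g b ->
  is_derive x 1 (fun y => f y + g y) (a + b).
Proof. by move=> df dg; exact: is_deriveD. Qed.

Lemma derive_sub f g x a b : is_derive x 1 f a -> is_derive x 1 g b ->
  is_derive x 1 (fun y => f y - g y) (a - b).
Proof. by move=> df dg; exact: is_deriveB. Qed.

Lemma derive_mul f g x a b : is_derive x 1 f a -> is_derive x 1 g b ->
  is_derive x 1 (fun y => f y * g y) (a * g x + f x * b).
Proof.
move=> df dg; have -> : a * g x + f x * b = f x *: b + g x *: a.
  by rewrite /GRing.scale/= addrC [g x * a]mulrC.
exact: is_deriveM.
Qed.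

Lemma derive_const (c : R) x : is_derive x 1 (fun _ : R => c) 0.
Proof. exact: is_derive_cst. Qed.

Lemma derive_id x : is_derive x 1 (fun y : R => y) 1.
Proof. exact: is_derive_id. Qed.

Lemma derive_sqr f x a : is_derive x 1 f a ->
  is_derive x 1 (fun y => f y ^+ 2) (2 * f x * a).
Proof.
move=> df; have -> : 2 * f x * a = a * f x + f x * a by ring.
exact: derive_mul.
Qed.

Lemma derive_scale (c : R) f x a : is_derive x 1 f a ->
  is_derive x 1 (fun y => c * f y) (c * a).
Proof. by move=> df; exact: is_deriveZ. Qed.

Lemma derive_comp f g x a b : is_derive (g x) 1 f a -> is_derive x 1 g b ->
  is_derive x 1 (fun y => f (g y)) (a * b).
Proof. by move=> df dg; exact: is_derive1_comp. Qed.

Lemma continuous_compose f g : continuous f -> continuous g ->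
  continuous (fun y : R => f (g y)).
Proof. by move=> cf cg x; apply: (@continuous_comp _ _ _ g f); [exact: cg|exact: cf]. Qed.

Lemma continuous_mulc (c : R) f : continuous f -> continuous (fun y : R => c * f y).
Proof. by move=> cf x; apply: cvgMr; exact: cf. Qed.

Lemma continuous_add f g : continuous f -> continuous g ->
  continuous (fun y : R => f y + g y).
Proof. by move=> cf cg x; apply: cvgD; [exact: cf|exact: cg]. Qed.

Lemma continuous_sub f g : continuous f -> continuous g ->
  continuous (fun y : R => f y - g y).
Proof. by move=> cf cg x; apply: cvgB; [exact: cf|exact: cg]. Qed.

Lemma continuous_mul f g : continuous f -> continuous g ->
  continuous (fun y : R => f y * g y).
Proof. by move=> cf cg x; apply: cvgM; [exact: cf|exact: cg]. Qed.

Lemma continuous_const (c : R) : continuous (fun _ : R => c).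
Proof. exact: cst_continuous. Qed.

Lemma continuous_sqr f : continuous f -> continuous (fun y : R => f y ^+ 2).
Proof.
by apply: (@continuous_compose (fun y => y ^+ 2)); exact: exprn_continuous.
Qed.

Lemma derive_near f g x a : (\near x, f x = g x) ->
  is_derive x 1 f a -> is_derive x 1 g a.
Proof. exact: (@near_eq_is_derive R R^o R^o). Qed.

Lemma derive_ge0_homo f (df : R -> R) (a b : R) : a <= b ->
  (forall x : R, is_derive x 1 f (df x)) ->
  (forall x, x \in `[a, b] -> 0 <= df x) -> f a <= f b.
Proof.
move=> ab fd df0.
have cf : continuous f by move=> x; exact: is_derive_continuous (fd x).
have [c cab e] := MVT_segment ab (fun x _ => fd x) (continuous_subspaceT cf).
by rewrite -subr_ge0 e mulr_ge0 ?df0// subr_ge0.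
Qed.

Lemma derive_gt0_homo f (df : R -> R) : (forall x : R, is_derive x 1 f (df x)) ->
  (forall x, 0 < df x) -> {homo f : x y / x < y}.
Proof.
move=> fd df0 x y xy.
have cf : continuous f by move=> z; exact: is_derive_continuous (fd z).
have [c cab e] := MVT xy (fun z _ => fd z) (continuous_subspaceT cf).
by rewrite -subr_gt0 e mulr_gt0 ?df0// subr_gt0.
Qed.

Lemma inverse_derive f g x a :
  continuous f -> cancel f g -> is_derive x 1 f a -> a != 0 ->
  is_derive (f x) 1 g a^-1.
Proof.
move=> cf fK fd nz; apply: is_derive_inverse => //.
- by near=> y; exact: fK.
- by near=> y; exact: cf.
Unshelve. all: by end_near. Qed.

End real_derivatives.

(** * The potential well *)

Section well_profile.
Context {R : realType}.
Variables s K : R.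
Hypotheses (s0 : 0 < s) (sK : 2 * s < K).

Definition cap : R := (K - 2 * s) / 2.
(** The orbits built below stay in the strip |a| < cap. Freezing |a| at cap
    beyond it turns the function well below into a bijection of the whole
    line, so that its inverse is total. *)
Definition capped (x : R) : R := Num.min `|x| cap.
Definition slack (x : R) : R := Num.sqrt (1 - ((2 * s + capped x / 2) / K) ^+ 2).
(** Write kappa = K^2 and g(a) = a (2 s + |a| / 2). The system has the
    Hamiltonian (kappa q - g(a))^2 / (2 kappa) + (a^2 - g(a)^2 / kappa) / 2,
    and in the strip well is the signed square root of a^2 - g(a)^2 / kappa. *)
Definition well (x : R) : R := x * slack x.
(** The derivative of well on the strip, written so that it is positive and
    continuous on the whole line. *)
Definition well' (x : R) : R :=
  (K ^+ 2 - 4 * s ^+ 2 - 3 * s * capped x - capped x ^+ 2 / 2) / (K ^+ 2 * slack x).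

Let K0 : 0 < K. Proof. by move: s0 sK; lra. Qed.

Lemma cap_gt0 : 0 < cap. Proof. by rewrite /cap; move: sK; lra. Qed.

Lemma capped_itv x : 0 <= capped x <= cap.
Proof. by rewrite /capped le_min normr_ge0 (ltW cap_gt0) ge_min lexx orbT. Qed.

Lemma continuous_capped : continuous capped.
Proof.
move=> x; apply: continuous_min; last exact: cst_continuous.
exact: norm_continuous.
Qed.

(** The inequality 2 s < K keeps the square root in slack away from 0,
    uniformly. *)
Lemma slack_arg x : (cap / K) ^+ 2 <= 1 - ((2 * s + capped x / 2) / K) ^+ 2.
Proof.
have /andP[] := capped_itv x; set m := capped x => m0 mc.
rewrite lerBrDr !expr_div_n -mulrDl ler_pdivrMr ?exprn_gt0// mul1r.
have h : (2 * s + m / 2) ^+ 2 <= (2 * s + cap / 2) ^+ 2.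
  by rewrite ler_pXn2r ?nnegrE//; move: mc m0 s0; lra.
apply: le_trans (lerD (lexx _) h) _.
by rewrite /cap; move: s0 sK; nra.
Qed.

Lemma slack_gt0 x : 0 < slack x.
Proof.
rewrite /slack sqrtr_gt0; apply: lt_le_trans (slack_arg x).
by rewrite exprn_gt0// divr_gt0// cap_gt0.
Qed.

Lemma slack_sqr x : slack x ^+ 2 = 1 - ((2 * s + capped x / 2) / K) ^+ 2.
Proof. by rewrite sqr_sqrtr// (le_trans _ (slack_arg x))// sqr_ge0. Qed.

Lemma slack_le1 x : slack x <= 1.
Proof.
have := slack_sqr x; have := sqr_ge0 ((2 * s + capped x / 2) / K).
have := slack_gt0 x; nra.
Qed.

Lemma continuous_slack : continuous slack.
Proof.
apply: (@continuous_compose _ Num.sqrt); first exact: sqrt_continuous.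
apply: continuous_sub; first exact: continuous_const.
apply: continuous_sqr; apply: continuous_mul; last exact: continuous_const.
apply: continuous_add; first exact: continuous_const.
apply: continuous_mul; last exact: continuous_const.
exact: continuous_capped.
Qed.

Lemma wellN x : well (- x) = - well x.
Proof. by rewrite /well /slack /capped normrN mulNr. Qed.

Lemma continuous_well : continuous well.
Proof. by apply: continuous_mul; [move=> x; exact: cvg_id|exact: continuous_slack]. Qed.

Lemma well'_gt0 x : 0 < well' x.
Proof.
have /andP[] := capped_itv x; rewrite /well'; set m := capped x => m0 mc.
rewrite divr_gt0// ?mulr_gt0 ?slack_gt0 ?exprn_gt0//.
by move: mc; rewrite /cap => mc; move: s0 sK; nra.
Qed.

Lemma continuous_well' : continuous well'.
Proof.
apply: continuous_mul; last first.
  move=> x; apply: cvgV; first by rewrite mulf_neq0// gt_eqF ?slack_gt0 ?exprn_gt0.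
  by apply: cvgMr; exact: continuous_slack.
apply: continuous_sub; last first.
  apply: continuous_mul; last exact: continuous_const.
  exact: continuous_sqr continuous_capped.
apply: continuous_sub; first exact: continuous_const.
exact: continuous_mulc continuous_capped.
Qed.

Lemma well_sqr x : (K * well x) ^+ 2 = (K * x) ^+ 2 - (x * (2 * s + capped x / 2)) ^+ 2.
Proof.
rewrite !exprMn slack_sqr expr_div_n; field.
by rewrite gt_eqF.
Qed.

(** After squaring, the claim is g(y)^2 - g(x)^2 < K^2 (y^2 - x^2), where
    g(x) = x (2 s + capped x / 2). It holds because g is K-Lipschitz and
    g(x) < K x for x > 0. *)
Lemma well_homo_ge0 (x y : R) : 0 <= x -> x < y -> well x < well y.
Proof.
move=> x0 xy.
have y0 : 0 < y by exact: le_lt_trans xy.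
have wx : 0 <= K * well x by rewrite !mulr_ge0// ltW ?slack_gt0.
have wy : 0 <= K * well y by rewrite !mulr_ge0// ltW ?slack_gt0.
rewrite -(ltr_pM2l K0) -(@ltr_pXn2r _ 2) ?nnegrE//.
rewrite !well_sqr.
have /andP[] := capped_itv x; have /andP[] := capped_itv y.
set m := capped x; set n := capped y => n0 nc m0 mc.
have d : y * (2 * s + n / 2) - x * (2 * s + m / 2) <= (y - x) * K.
  rewrite /n /m /capped (ger0_norm x0) (ger0_norm (ltW y0)).
  rewrite /cap; case: (leP x); case: (leP y) => ? ?; move: s0 sK; nra.
have d' : y * (2 * s + n / 2) + x * (2 * s + m / 2) < (y + x) * K.
  by move: nc mc; rewrite /cap; move: s0 sK; nra.
have p : 0 < y * (2 * s + n / 2) + x * (2 * s + m / 2).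
  by move: s0; nra.
rewrite -subr_gt0.
rewrite (_ : _ - _ = (y - x) * K * ((y + x) * K) -
   (y * (2 * s + n / 2) - x * (2 * s + m / 2)) *
   (y * (2 * s + n / 2) + x * (2 * s + m / 2))); last by ring.
rewrite subr_gt0 (le_lt_trans (ler_wpM2r (ltW p) d))//.
by rewrite ltr_pM2l// mulr_gt0// subr_gt0.
Qed.

Lemma well_homo : {homo well : x y / x < y}.
Proof.
move=> x y xy; have [x0|x0] := leP 0 x; first exact: well_homo_ge0.
have [y0|y0] := leP 0 y.
  apply: (@lt_le_trans _ _ 0); first by rewrite pmulr_llt0 ?slack_gt0.
  by rewrite mulr_ge0// ltW ?slack_gt0.
by rewrite -ltrN2 -!wellN well_homo_ge0 ?ltrN2// lerNr oppr0 ltW.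
Qed.

Lemma well_ge x : 0 <= x -> x * (cap / K) <= well x.
Proof.
move=> x0; rewrite ler_wpM2l// -(@ler_pXn2r _ 2) ?nnegrE ?slack_sqr ?slack_arg//.
  by rewrite ltW// divr_gt0// cap_gt0.
by rewrite ltW// slack_gt0.
Qed.

Lemma well_derive_gt0 (x : R) : 0 < x < cap -> is_derive x 1 well (well' x).
Proof.
move=> /andP[x0 xc].
pose u (y : R) := (2 * s + y / 2) / K.
have cx : capped x = x by rewrite /capped gtr0_norm// min_l// ltW.
have du : is_derive x 1 u (2^-1 / K).
  have -> : 2^-1 / K = (0 + (1 * 2^-1 + x * 0)) * K^-1 + (2 * s + x / 2) * 0 :> R.
    by ring.
  exact: (derive_mul (derive_add (derive_const (2 * s) x)
    (derive_mul (derive_id x) (derive_const 2^-1 x))) (derive_const K^-1 x)).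
have dv := derive_sub (derive_const 1 x) (derive_sqr du).
have ux : 0 < 1 - u x ^+ 2.
  rewrite /u -{1}cx; apply: lt_le_trans (slack_arg x).
  by rewrite exprn_gt0// divr_gt0// cap_gt0.
have H := derive_mul (derive_id x)
  (@derive_comp _ Num.sqrt (fun y => 1 - u y ^+ 2) x _ _ (is_derive1_sqrt ux) dv).
apply: (@derive_near _ (fun y => y * Num.sqrt (1 - u y ^+ 2))).
  near=> y; rewrite /well /slack /capped.
  have /andP[y0 yc] : 0 < y < cap.
    by near: y; apply: (@near_in_itvoo _ 0 cap); rewrite in_itv/= x0.
  by rewrite gtr0_norm// min_l// ltW.
apply: (is_derive_eq H).
have sx : Num.sqrt (1 - u x ^+ 2) = slack x by rewrite /slack cx.
rewrite /well' sx cx.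
have := slack_sqr x; rewrite cx -/(u x); have := slack_gt0 x; move: (slack x) => r r0 re.
have K0' : K != 0 by rewrite gt_eqF.
have r0' : r != 0 by rewrite gt_eqF.
apply: (@mulIf _ (K ^+ 2 * r)); first by rewrite mulf_neq0// expf_neq0.
rewrite divfK ?mulf_neq0 ?expf_neq0//.
rewrite [LHS](_ : _ = K ^+ 2 * r ^+ 2 - x * K * u x / 2); last first.
  field; rewrite r0' K0'; done.
by rewrite re /u; field.
Unshelve. all: by end_near. Qed.

Lemma well'N x : well' (- x) = well' x.
Proof. by rewrite /well' /slack /capped normrN. Qed.

(** Away from 0 the absolute value is smooth and the parity of well reduces
    the claim to positive x. At 0 the factorization well x = x slack x gives
    the derivative. *)
Lemma well_derive (x : R) : `|x| < cap -> is_derive x 1 well (well' x).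
Proof.
move=> xc; have [x0|x0|x0] := ltgtP x 0; last first.
- rewrite x0; apply/is_derive1_caratheodory; exists slack; split.
  + by move=> z; rewrite /well mul0r !subr0 mulrC.
  + exact: continuous_slack.
  + rewrite /well'; have := slack_sqr 0.
    have -> : capped 0 = 0 by rewrite /capped normr0 min_l// ltW// cap_gt0.
    have := slack_gt0 0; move: (slack 0) => r r0 re.
    have K0' : K != 0 by rewrite gt_eqF.
    have r0' : r != 0 by rewrite gt_eqF.
    apply: (@mulIf _ (K ^+ 2 * r)); first by rewrite mulf_neq0// expf_neq0.
    rewrite divfK ?mulf_neq0 ?expf_neq0//.
    by rewrite mulrCA -expr2 re; field.
- by apply: well_derive_gt0; rewrite x0 -(gtr0_norm x0).
- have H : is_derive (- x) 1 well (well' (- x)).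
    by apply: well_derive_gt0; rewrite oppr_gt0 x0 -(ltr0_norm x0).
  have := derive_sub (derive_const 0 x)
    (@derive_comp _ well -%R x _ _ H (is_deriveNid x 1)).
  rewrite well'N mulrN1 sub0r opprK.
  by apply: derive_near; near=> y; rewrite /= wellN sub0r opprK.
Unshelve. all: by end_near. Qed.

Lemma well_inverse : exists2 v : R -> R, cancel well v & cancel v well.
Proof.
apply: increasing_bijection; [exact: continuous_well|exact: well_homo|].
have cK : 0 < cap / K by rewrite divr_gt0// cap_gt0.
move=> y; pose x := `|y| / (cap / K).
have x0 : 0 <= x by rewrite divr_ge0// ltW.
have yx : `|y| <= well x by rewrite (le_trans _ (well_ge x0))// divfK// gt_eqF.
exists (- x), x; rewrite wellN.
by rewrite (le_trans _ yx) ?ler_norm// andbT lerNl (le_trans _ yx)// -normrN ler_norm.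
Qed.

End well_profile.

(** * Closed orbits around the origin *)

Lemma inverse_continuous (R : realType) (f g : R -> R) :
  continuous f -> cancel f g -> cancel g f -> continuous g.
Proof.
move=> cf fK gK y; rewrite -(gK y).
have : {near f (g y), continuous g}.
  by apply: near_can_continuous; near=> z; [exact: fK|exact: cf].
exact: nbhs_singleton.
Unshelve. all: by end_near. Qed.

Lemma polar_angle (R : realType) (u v : R) : u ^+ 2 + v ^+ 2 = 1 ->
  exists th, u = cos th /\ v = sin th.
Proof.
move=> uv.
have u1 : -1 <= u <= 1.
  by rewrite -ler_norml -(@ler_pXn2r _ 2) ?nnegrE// real_normK ?num_real// expr1n -uv lerDl sqr_ge0.
have e : Num.sqrt (1 - u ^+ 2) = `|v| by rewrite -uv addrC addKr sqrtr_sqr.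
have [v0|v0] := leP 0 v.
  by exists (acos u); rewrite acosK ?in_itv//= sin_acos// e ger0_norm.
exists (- acos u); rewrite cosN sinN acosK ?in_itv//= sin_acos// e ltr0_norm//.
by rewrite opprK.
Qed.

(** A positive speed h on the circle is integrated by separation of
    variables. The time T(x) needed to reach the angle x is the integral of
    1 / h, and the angle th is the inverse of T. Since h is periodic, T
    grows by the same amount tau over each turn. *)
Lemma circle_flow (R : realType) (h : R -> R) : continuous h ->
  (forall x, 0 < h x) -> periodic h (pi *+ 2) ->
  exists (th : R -> R) (tau : R), [/\ 0 < tau, th 0 = 0,
    forall t : R, is_derive t 1 th (h (th t)),
    forall t, th (t + tau) = th t + pi *+ 2 &
    forall x : R, exists2 t : R, (0 <= x -> 0 <= t) & th t = x].
Proof.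
move=> ch h0 hp.
have cV : continuous (fun x => (h x)^-1).
  by move=> x; apply: cvgV; [rewrite gt_eqF|exact: ch].
have [T T0 dT] := antiderivative cV.
have Tm : {homo T : x y / x < y}.
  by apply: (derive_gt0_homo dT) => x; rewrite invr_gt0.
have cT : continuous T by move=> x; exact: is_derive_continuous (dT x).
pose tau := T (pi *+ 2).
have tau0 : 0 < tau by rewrite -T0; apply: Tm; rewrite mulrn_wgt0// pi_gt0.
have TD x : T (x + pi *+ 2) = T x + tau.
  pose D x := T (x + pi *+ 2) - T x.
  have dD (y : R) : is_derive y 1 D 0.
    have e : 0 = (h (y + pi *+ 2))^-1 * (1 + 0) - (h y)^-1.
      by rewrite hp addr0 mulr1 subrr.
    rewrite [X in is_derive _ _ _ X]e; apply: derive_sub (dT y).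
  have := is_derive_0_is_cst x 0 dD; rewrite /D add0r T0 subr0 -/tau => <-.
  by rewrite [RHS]addrC subrK.
have TDn n x : T (x + (pi *+ 2) *+ n) = T x + tau *+ n.
  elim: n => [|n IH]; first by rewrite !mulr0n !addr0.
  by rewrite (mulrSr (pi *+ 2) n) (mulrSr tau n) addrA TD IH -addrA.
have [|th TK thK] := increasing_bijection cT Tm.
  move=> y; pose n := Num.bound `|y / tau|.
  have yn : `|y| <= tau *+ n.
    rewrite -mulr_natl -ler_pdivrMr// -[X in _ / X](gtr0_norm tau0) -normf_div.
    by rewrite ltW// archi_boundP.
  exists (- ((pi *+ 2) *+ n)), ((pi *+ 2) *+ n).
  have := TDn n (- ((pi *+ 2) *+ n)); rewrite addNr T0 => /eqP.
  rewrite eq_sym addrC addr_eq0 => /eqP e.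
  have := TDn n 0; rewrite add0r T0 add0r => ->.
  rewrite (le_trans (ler_norm _) yn) andbT.
  have -> : T (- ((pi *+ 2) *+ n)) = - (tau *+ n) by rewrite e opprK.
  by rewrite lerNl (le_trans _ yn)// -normrN ler_norm.
have thinj : injective T by exact: can_inj TK.
exists th, tau; split => //.
- by rewrite -T0 TK.
- move=> t; have nz : (h (th t))^-1 != 0 by rewrite invr_neq0// gt_eqF.
  have := inverse_derive (x := th t) cT TK (dT _) nz.
  by rewrite thK invrK.
- by move=> t; apply: thinj; rewrite TD !thK.
- move=> x; exists (T x); last exact: TK.
  rewrite le_eqVlt => /predU1P[<-|x0]; first by rewrite T0.
  by rewrite -T0 ltW// Tm.
Qed.

Section drift_field.
Context {R : realType}.
Variable s : R.

Definition drift (a : R) : R := 2 * s * a + 2^-1 * Num.sg a * a ^+ 2.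

Lemma driftE a : drift a = a * (2 * s + `|a| / 2).
Proof.
rewrite /drift; case: (ltrgtP a 0) => [a0|a0|->].
- by rewrite ltr0_sg// ltr0_norm//; field.
- by rewrite gtr0_sg// gtr0_norm//; field.
- by rewrite sgr0 normr0; ring.
Qed.

Lemma derive_normM (x : R) : is_derive x 1 (fun y : R => y * `|y|) (2 * `|x|).
Proof.
have sq (z : R) : is_derive z 1 (fun y : R => y * y) (2 * z).
  have -> : 2 * z = 1 * z + z * 1 by ring.
  exact: (derive_mul (derive_id z) (derive_id z)).
have [x0|x0|->] := ltgtP x 0.
- rewrite ltr0_norm//.
  have := derive_sub (derive_const 0 x) (sq x); rewrite sub0r -mulrN.
  apply: derive_near; near=> y; rewrite ltr0_norm ?mulrN ?sub0r//.
  by near: y; exact: lt_nbhsl.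
- rewrite gtr0_norm//; apply: derive_near (sq x); near=> y.
  by rewrite gtr0_norm//; near: y; exact: lt_nbhsr.
- rewrite normr0 mulr0; apply/is_derive1_caratheodory; exists Num.norm; split.
  + by move=> z; rewrite mul0r !subr0 mulrC.
  + exact: norm_continuous.
  + by rewrite normr0.
Unshelve. all: by end_near. Qed.

Lemma derive_drift (x : R) : is_derive x 1 drift (2 * s + `|x|).
Proof.
have := derive_add (derive_scale (2 * s) (derive_id x)) (derive_scale 2^-1 (derive_normM x)).
have -> : 2 * s * 1 + 2^-1 * (2 * `|x|) = 2 * s + `|x| by field.
by apply: derive_near; near=> y; rewrite driftE; field.
Unshelve. all: by end_near. Qed.

End drift_field.

Section closed_orbits.
Context {R : realType}.
Variables s K : R.
Hypotheses (s0 : 0 < s) (sK : 2 * s < K).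

Let K0 : 0 < K. Proof. by move: s0 sK; lra. Qed.
Let Knz : K != 0. Proof. by rewrite gt_eqF. Qed.

Local Notation well := (well s K).
Local Notation well' := (well' s K).
Local Notation cap := (cap s K).
Local Notation capped := (capped s K).

(** This is - a' / K along the solutions that stay in the strip. *)
Definition skew (z : R * R) : R :=
  K * z.2 - z.1 * (2 * s + capped z.1 / 2) / K.

(** Twice the Hamiltonian inside the strip. Outside, the frozen profile
    keeps it proper. *)
Definition energy (z : R * R) : R := skew z ^+ 2 + well z.1 ^+ 2.

Lemma continuous_energy : continuous energy.
Proof.
have cf : continuous (fun z : R * R => z.1) by move=> z; exact: cvg_fst.
have cs : continuous (fun z : R * R => z.2) by move=> z; exact: cvg_snd.
have cc (f : R -> R) : continuous f -> continuous (fun z : R * R => f z.1).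
  by move=> c z; apply: (@continuous_comp _ _ _ (fun z : R * R => z.1) f); [exact: cf|exact: c].
have sq (f : R * R -> R) : continuous f -> continuous (fun z : R * R => f z ^+ 2).
  move=> c z; apply: (@continuous_comp _ _ _ f (fun y : R => y ^+ 2)); first exact: c.
  exact: exprn_continuous.
have ck : continuous skew.
  move=> z; apply: cvgB; first by apply: cvgMr; exact: cs.
  apply: cvgMl; apply: (cc (fun x => x * (2 * s + capped x / 2))).
  apply: continuous_mul; first by move=> x; exact: cvg_id.
  apply: continuous_add; first exact: continuous_const.
  apply: continuous_mul; last exact: continuous_const.
  exact: continuous_capped.
move=> z; apply: cvgD; first exact: sq ck _.
by apply: sq; apply: cc; exact: continuous_well.
Qed.

Lemma bounded_energy (r : R) : bounded_set [set z : R * R | energy z < r ^+ 2].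
Proof.
have c0 : 0 < cap / K by rewrite divr_gt0// cap_gt0.
pose X : R := `|r| / (cap / K).
pose Y : R := (`|r| + X * (2 * s + cap / 2) / K) / K.
exists (Num.max X Y); split; first exact: num_real.
move=> M XYM z /= ez.
have wl : `|well z.1| <= `|r|.
  rewrite -(@ler_pXn2r _ 2) ?nnegrE// !real_normK ?num_real//.
  by rewrite (le_trans _ (ltW ez))// lerDr sqr_ge0.
have vl : `|skew z| <= `|r|.
  rewrite -(@ler_pXn2r _ 2) ?nnegrE// !real_normK ?num_real//.
  by rewrite (le_trans _ (ltW ez))// lerDl sqr_ge0.
have xl : `|z.1| <= X.
  rewrite ler_pdivlMr// (le_trans _ wl)//.
  have [x0|x0] := leP 0 z.1.
    by rewrite !ger0_norm// ?well_ge// mulr_ge0// ltW// slack_gt0.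
  rewrite ltr0_norm// -normrN -wellN ger0_norm.
    by apply: well_ge => //; rewrite oppr_ge0 ltW.
  by rewrite mulr_ge0 ?oppr_ge0 ?(ltW x0)// ltW// slack_gt0.
have yl : `|z.2| <= Y.
  rewrite ler_pdivlMr// -[X in _ * X](gtr0_norm K0) -normrM.
  have -> : z.2 * K = skew z + z.1 * (2 * s + capped z.1 / 2) / K.
    by rewrite /skew subrK mulrC.
  rewrite (le_trans (ler_normD _ _))// lerD// !normrM normfV (gtr0_norm K0).
  rewrite ler_pM2r ?invr_gt0// ler_pM//.
  have /andP[c1 c2] := capped_itv sK z.1.
  by rewrite ger0_norm; move: s0 c1 c2; lra.
have : Num.max `|z.1| `|z.2| <= M.
  apply: le_trans (ltW XYM).
  by rewrite ge_max !le_max xl yl orbT.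
by [].
Qed.

(** A connected set through the origin that avoids the level r^2 takes its
    energies in an interval that contains 0 but not r^2. It lies in a
    bounded sublevel set. *)
Lemma energy_curve_encloses (r : R) : 0 < r ->
  encloses [set z | energy z = r ^+ 2] (0, 0).
Proof.
move=> r0; have e0 : energy (0, 0) = 0.
  by rewrite /energy /skew /well /= mulr0 !mul0r subrr expr0n addr0.
have r20 : 0 < r ^+ 2 by rewrite exprn_gt0.
have nC : ~ [set z | energy z = r ^+ 2] (0, 0).
  by rewrite /= e0 => h; rewrite -h ltxx in r20.
split=> //; set B := connected_component _ _.
suff BE : B `<=` [set z | energy z < r ^+ 2].
  have [M [rM hM]] := bounded_energy r.
  by exists M; split=> // y My z /BE; exact: hM.
move=> z Bz /=; rewrite ltNge; apply/negP => rz.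
have cB : connected (energy @` B).
  apply: connected_continuous_connected; first exact: component_connected.
  by apply: continuous_subspaceT; exact: continuous_energy.
have B0 : B (0, 0) by exact: connected_component_refl.
have /connected_intervalP := cB.
move=> /(_ (energy (0, 0)) (energy z)).
case/(_ _ _ (r ^+ 2)); [by exists (0, 0)|by exists z|by rewrite e0 (ltW r20)|].
by move=> y /connected_component_sub.
Qed.

(** The level set of the energy is the circle well a = r sin th, skew (a, q)
    = - r cos th. In this angle the two equations become th' = K well'(a), a
    positive function of th alone, which circle_flow integrates. The whole
    level set is one orbit because th reaches every angle. *)
Lemma closed_orbit (r : R) : 0 < r < well cap ->
  exists a q : R -> R, [/\
    forall t : R, is_derive t 1 a (drift s (a t) - K ^+ 2 * q t) /\
      is_derive t 1 q (a t - (2 * s + `|a t|) * q t),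
    periodic_pair a q,
    (exists u t, 0 <= u /\ 0 <= t /\ q u <> q t),
    (forall t, energy (a t, q t) = r ^+ 2) /\ encloses (orbit a q) (0, 0) &
    forall t, `|a t| <= cap /\ `|q t| < 1].
Proof.
move=> /andP[r0 rc].
have [wi wK wiK] := well_inverse s0 sK.
have cw : continuous well by exact: continuous_well.
have ci : continuous wi by exact: inverse_continuous wK wiK.
pose A x := wi (r * sin x).
have cA : continuous A.
  apply: (@continuous_compose _ wi (fun x => r * sin x)) => //.
  by apply: continuous_mulc; exact: continuous_sin.
have Ac x : `|A x| < cap.
  have : `|r * sin x| < well cap.
    rewrite (le_lt_trans _ rc)// normrM (gtr0_norm r0) ler_piMr ?(ltW r0)//.
    by rewrite ler_norml sin_geN1 sin_le1.
  rewrite !ltr_norml -wellN => /andP[lo up].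
  rewrite -(leW_mono (le_mono (well_homo s0 sK)) (A x)) wiK up andbT.
  by rewrite -(leW_mono (le_mono (well_homo s0 sK)) (- cap)) wiK lo.
pose h x := K * well' (A x).
have hp : periodic h (pi *+ 2) by move=> x; rewrite /h /A sinD2pi.
have [||th [tau [tau0 th0 dth thp ths]]] := @circle_flow R h _ _ hp.
- by apply: continuous_mulc; apply: continuous_compose cA; exact: continuous_well'.
- by move=> x; rewrite mulr_gt0// well'_gt0.
pose a t := A (th t).
pose q t := (drift s (a t) / K - r * cos (th t)) / K.
have da (t : R) : is_derive t 1 a (K * (r * cos (th t))).
  have w0 : 0 < well' (a t) by exact: well'_gt0.
  have dw := inverse_derive cw wK (well_derive s0 sK (Ac (th t))) (lt0r_neq0 w0).
  rewrite wiK in dw.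
  have dr := derive_scale r (derive_comp (is_derive_sin (th t)) (dth t)).
  have := @derive_comp _ wi (fun t => r * sin (th t)) t _ _ dw dr.
  move=> /is_derive_eq; apply; rewrite /h -/(a t).
  by field; rewrite gt_eqF.
have ad (t : R) : drift s (a t) - K ^+ 2 * q t = K * (r * cos (th t)).
  by rewrite /q; field.
(* The potential part of Newton's equation for a: well times its derivative
   is a - g(a) g'(a) / K^2, where g = drift s. *)
have wwE (t : R) : r * sin (th t) * well' (a t) =
    a t - (2 * s + `|a t|) * drift s (a t) / K ^+ 2.
  rewrite -[r * sin _]wiK -/(A _) -/(a t) /well /well' driftE.
  have -> : capped (a t) = `|a t| by rewrite /capped min_l// ltW// Ac.
  have := slack_gt0 s0 sK (a t); move: (slack _ _ _) => sl sl0.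
  have Kz := Knz; have slz := lt0r_neq0 sl0.
  move: (`|_|) => m; field; rewrite Kz slz; done.
have dq (t : R) : is_derive t 1 q (a t - (2 * s + `|a t|) * q t).
  have d1 := @derive_comp _ (drift s) a t _ _ (derive_drift s (a t)) (da t).
  have d2 := derive_scale r (derive_comp (is_derive_cos (th t)) (dth t)).
  have := derive_mul (derive_sub (derive_mul d1 (derive_const K^-1 t)) d2) (derive_const K^-1 t).
  move=> /is_derive_eq; apply; rewrite /h -/(a t).
  transitivity ((2 * s + `|a t|) * (r * cos (th t)) / K + r * sin (th t) * well' (a t)).
    by field.
  by rewrite wwE /q; field.
have enE t : energy (a t, q t) = r ^+ 2.
  rewrite /energy /skew /=.
  have -> : capped (a t) = `|a t| by rewrite /capped min_l// ltW// Ac.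
  rewrite -driftE wiK.
  have -> : K * q t - drift s (a t) / K = - (r * cos (th t)) by rewrite /q; field.
  by rewrite sqrrN !exprMn -mulrDr cos2Dsin2 mulr1.
have oE : orbit a q = [set z | energy z = r ^+ 2].
  apply/seteqP; split=> [_ [t _ <-]|[x y] /= e]; first exact: enE.
  have rz : r != 0 by rewrite gt_eqF.
  have [|ph [cph sph]] := @polar_angle _ (- skew (x, y) / r) (well x / r).
    rewrite !expr_div_n sqrrN -mulrDl -[X in X / _]/(energy (x, y)) e divff//.
    by rewrite expf_neq0.
  have [t _ tph] := ths ph; exists t => //.
  have ax : a t = x by rewrite /a /A tph -sph mulrC divfK// wK.
  have xc : capped x = `|x| by rewrite /capped min_l// ltW// -ax Ac.
  rewrite ax /q ax tph -cph /skew /= xc -driftE; congr pair.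
  by field; rewrite rz Knz.
exists a, q; split.
- by move=> t; rewrite ad; split.
- exists tau => // t; rewrite /q /a /A thp sinD2pi cosD2pi; done.
- have [t t0 tp] := ths pi.
  exists 0, t; split=> //; split; first by rewrite t0// ltW// pi_gt0.
  rewrite /q /a /A th0 tp sinpi cospi sin0 cos0.
  move=> /eqP; rewrite (inj_eq (mulIf (invr_neq0 Knz))) (inj_eq (addrI _)).
  rewrite !mulr1 mulrN1 opprK => /eqP; move: r0; lra.
- by split=> //; rewrite oE; exact: energy_curve_encloses.
- move=> t; have /ltW at_cap := Ac (th t); split=> //.
  have dr : `|drift s (a t) / K| <= cap.
    rewrite driftE normrM normfV (gtr0_norm K0) ler_pdivrMr// normrM ler_pM//.
    rewrite ger0_norm; last by move: s0 (normr_ge0 (a t)); lra.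
    by move: at_cap; rewrite -/(a t) /cap; move: s0 sK; lra.
  have rc' : `|r * cos (th t)| < cap.
    rewrite (@le_lt_trans _ _ r)//.
      rewrite normrM (gtr0_norm r0) ler_piMr ?(ltW r0)//.
      by rewrite ler_norml cos_geN1 cos_le1.
    by rewrite (lt_le_trans rc)// ler_piMr ?slack_le1// ltW// cap_gt0.
  rewrite /q normrM normfV (gtr0_norm K0) ltr_pdivrMr// mul1r.
  rewrite (le_lt_trans (ler_normB _ _))//.
  by move: dr rc'; rewrite /cap; move: s0 sK; lra.
Qed.

End closed_orbits.

(** * Random bits with prescribed laws *)

Lemma uniform_prob_itv (R : realType) (c l : R) : 0 <= c -> 0 <= l -> c + l <= 1 ->
  uniform_prob (@ltr01 R) `[c, c + l[ = l%:E.
Proof.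
move=> c0 l0 cl1; rewrite /uniform_prob integral_uniform_pdf.
have sub : `[c, c + l[ `<=` `[0, 1].
  by move=> x; rewrite /= !in_itv/= => /andP[cx xl]; rewrite (le_trans c0)//= (le_trans (ltW xl)).
rewrite setIidl//.
rewrite (eq_integral (fun=> 1%:E)); last first.
  move=> x; rewrite inE => /sub; rewrite /= in_itv/= => x01.
  by rewrite /uniform_pdf x01 subr0 invr1.
rewrite integral_cst//= mul1e lebesgue_measure_itv/= lte_fin.
case: ltP => h; first by rewrite -EFinB addrAC subrr add0r.
by congr EFin; apply/eqP; rewrite eq_le l0/= -(lerD2l c) addr0.
Qed.

Lemma uniform_prob_trace (R : realType) (A : set R) (c l : R) : measurable A ->
  0 <= c -> 0 <= l -> c + l <= 1 -> A `&` `[0, 1[ = [set` `[c, c + l[] ->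
  uniform_prob (@ltr01 R) A = l%:E.
Proof.
move=> mA c0 l0 cl1 AE.
pose P : probability (measurableTypeR R) R := uniform_prob (@ltr01 R).
have e1 : P `[0, 1[%classic = 1%:E.
  by have := @uniform_prob_itv R 0 1; rewrite add0r; apply.
have e2 : P `[c, c + l[%classic = l%:E by exact: uniform_prob_itv.
rewrite -[LHS]/(P A).
have mI : measurable (`[0, 1[ : set R) by exact: measurable_itv.
have e3 : P (~` `[0, 1[%classic) = 0%E.
  by rewrite (@probability_setC _ _ _ P _ mI) e1 subee.
rewrite -[A in LHS](setIT) -(setUv `[0, 1[%classic) setIUr measureU//.
- rewrite [X in (X + _)%E](_ : _ = l%:E); last by rewrite -e2 -AE.
  rewrite [X in (_ + X)%E](_ : _ = 0%E) ?adde0//.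
  apply: (@subset_measure0 _ _ _ P _ (~` `[0, 1[)) => //.
  + by apply: measurableI => //; exact: measurableC.
  + exact: measurableC.
- exact: measurableI.
- by apply: measurableI => //; exact: measurableC.
- by rewrite setIACA setICr setI0.
Qed.

Section binary_process.
Context {R : realType}.
Variable w : seq bool -> R.
Hypotheses (w_nil : w [::] = 1) (w_ge0 : forall s, 0 <= w s).
Hypothesis w_rcons : forall s, w s = w (rcons s false) + w (rcons s true).

(* Cells are indexed by words in reverse order: the last letter comes first. *)
Let v (s : seq bool) : R := w (rev s).

Let v_cons s : v s = v (false :: s) + v (true :: s).
Proof. by rewrite /v !rev_cons. Qed.

(** A word s owns the cell [cell_start s, cell_start s + v s[ of [0, 1[, and
    its two extensions share this cell in proportion to their weights. *)
Fixpoint cell_start (s : seq bool) : R :=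
  if s is b :: s' then cell_start s' + (if b then v (false :: s') else 0) else 0.

Definition next_bit (s : seq bool) (x : R) : bool := cell_start s + v (false :: s) <= x.

Fixpoint cell_code (n : nat) (x : R) : seq bool :=
  if n is n'.+1 then next_bit (cell_code n' x) x :: cell_code n' x else [::].

Definition code_bit (n : nat) (x : R) : bool := next_bit (cell_code n x) x.

Lemma size_cell_code n x : size (cell_code n x) = n.
Proof. by elim: n => //= n ->. Qed.

Lemma rev_cell_code n x : rev (cell_code n x) = mkseq (code_bit^~ x) n.
Proof. by elim: n => // n IH; rewrite mkseqS /= rev_cons IH. Qed.

Lemma cell_start_ge0 s : 0 <= cell_start s.
Proof. by elim: s => //= b s IH; case: b; rewrite ?addr0// addr_ge0// w_ge0. Qed.

Lemma cell_end_le1 s : cell_start s + v s <= 1.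
Proof.
elim: s => /= [|b s IH]; first by rewrite add0r /v w_nil.
rewrite (le_trans _ IH)// (v_cons s); case: b; first by rewrite addrA.
by rewrite addr0 lerD2l lerDl w_ge0.
Qed.

Lemma cell_codeE s x : 0 <= x < 1 ->
  (cell_code (size s) x == s) = (cell_start s <= x < cell_start s + v s).
Proof.
move=> x01; elim: s => [|b s IH]; first by rewrite /= /v w_nil add0r eqxx x01.
rewrite /= eqseq_cons.
have [sE|sN] := eqVneq (cell_code (size s) x) s; last first.
  move/negbTE: sN; rewrite andbF => sN; move: IH; rewrite sN.
  rewrite (v_cons s); have := w_ge0 (rev (false :: s)); have := w_ge0 (rev (true :: s)).
  rewrite -/(v _) -/(v (false :: s)) => v1 v2.
  case: b; move/esym/negbT; rewrite negb_and -ltNge -leNgt.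
    move=> /orP[h|h]; apply/esym/negbTE; rewrite negb_and -ltNge -leNgt.
      by rewrite (lt_le_trans h) ?lerDl.
    by rewrite -addrA h orbT.
  move=> /orP[h|h]; apply/esym/negbTE; rewrite negb_and -ltNge -leNgt addr0.
    by rewrite h.
  by rewrite (le_trans _ h) ?orbT// lerD2l lerDl.
move: IH; rewrite sE eqxx andbT => /esym/andP[lo up].
rewrite /next_bit; case: b; last by rewrite addr0 lo /= eqbF_neg -ltNge.
by rewrite eqb_id -addrA -v_cons up andbT.
Qed.

Lemma measurable_cell_code n s : measurable [set x | cell_code n x = s].
Proof.
elim: n s => [|n IH] s.
  have [->|sN] := eqVneq s [::].
    by rewrite (_ : [set _ | _] = setT)//; apply/seteqP; split.
  rewrite (_ : [set _ | _] = set0)//; apply/seteqP; split=> // x /= e.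
  by rewrite -e eqxx in sN.
case: s => [|b s]; first by rewrite (_ : [set _ | _] = set0)//; apply/seteqP; split.
rewrite (_ : [set _ | _] = [set x | cell_code n x = s] `&` [set x | next_bit s x = b]).
  apply: measurableI; first exact: IH.
  rewrite /next_bit; case: b.
    rewrite (_ : [set _ | _] = `[cell_start s + v (false :: s), +oo[%classic)//.
    by apply/seteqP; split=> x /=; rewrite in_itv/= andbT.
  rewrite (_ : [set _ | _] = `]-oo, cell_start s + v (false :: s)[%classic)//.
  by apply/seteqP; split=> x /=; rewrite in_itv/= ltNge; [move=> ->|move=> /negbTE].
apply/seteqP; split=> x /=; first by case=> <- <-.
by case=> -> ->.
Qed.

Lemma measurable_code_bit n : measurable_fun setT (code_bit n).
Proof.
apply: (measurable_fun_bool true); rewrite setTI.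
rewrite (_ : _ @^-1` _ = \bigcup_(s in [set: n.-tuple bool])
  [set x | cell_code n.+1 x = true :: s]).
  by apply: fin_bigcup_measurable => // s _; exact: measurable_cell_code.
apply/seteqP; split=> x /=.
  move=> bx; exists (tcast (size_cell_code n x) (in_tuple (cell_code n x))) => //=.
  by rewrite val_tcast -/(code_bit n x) bx.
by case=> s _ [].
Qed.

(** Consistent weights on finite words are the law of a sequence of random
    bits: pick a uniform point of [0, 1] and follow the nested cells that
    contain it. *)
Lemma binary_process : exists (d : measure_display) (T : measurableType d)
    (P : probability T R) (xi : nat -> T -> bool),
  (forall n, measurable_fun setT (xi n)) /\
  forall n s, size s = n -> P [set x | mkseq (xi^~ x) n = s] = (w s)%:E.
Proof.
exists _, _, (uniform_prob (@ltr01 R)), code_bit; split; first exact: measurable_code_bit.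
move=> n s <-{n}.
rewrite (_ : [set _ | _] = [set x | cell_code (size s) x = rev s]); last first.
  apply/seteqP; split=> x /=; first by rewrite -rev_cell_code => /(congr1 rev); rewrite revK.
  by rewrite -rev_cell_code => ->; rewrite revK.
apply: (@uniform_prob_trace _ _ (cell_start (rev s))).
- exact: measurable_cell_code.
- exact: cell_start_ge0.
- exact: w_ge0.
- by have := cell_end_le1 (rev s); rewrite /v revK.
apply/seteqP; split=> x /=; rewrite !in_itv/=.
  case=> e x01; have := @cell_codeE (rev s) x x01.
  by rewrite /v revK size_rev e eqxx => <-.
move=> /andP[lo up]; have x01 : 0 <= x < 1.
  rewrite (le_trans (cell_start_ge0 (rev s)) lo)/= (lt_le_trans up)//.
  by have := cell_end_le1 (rev s); rewrite /v revK.
split=> //; apply/eqP; rewrite -(size_rev s) cell_codeE// lo /v revK; exact: up.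
Qed.

End binary_process.

(** * Markov laws along finitely many times *)

(** Laws p and transition probabilities Pr of a Markov process with values
    in bool, over all real times. The Chapman-Kolmogorov equation is
    step_comp. *)
Record markov_family {R : realType} (p : R -> bool -> R)
    (Pr : R -> R -> bool -> bool -> R) : Prop := {
  law_ge0 : forall t y, 0 <= p t y;
  law_sum : forall t, p t false + p t true = 1;
  step_ge0 : forall s t x y, s <= t -> 0 <= Pr s t x y;
  step_sum : forall s t x, s <= t -> Pr s t x false + Pr s t x true = 1;
  step_refl : forall t x y, Pr t t x y = (x == y)%:R;
  step_comp : forall s t u x y, s <= t -> t <= u ->
    Pr s t x false * Pr t u false y + Pr s t x true * Pr t u true y = Pr s u x y;
  law_step : forall s t y, s <= t ->
    p s false * Pr s t false y + p s true * Pr s t true y = p t y }.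

Section skeleton.
Context {R : realType}.
Variables (p : R -> bool -> R) (Pr : R -> R -> bool -> bool -> R).
Hypothesis mf : markov_family p Pr.
Implicit Types (s t : R) (l : seq R) (f : R -> bool).

(** The function f prescribes a state at each time. The weights are the
    probabilities that a process with these transitions follows f along an
    increasing list of times, given its state at time s for chain_weight,
    and with the law p at the first time for path_weight. *)
Fixpoint chain_weight s l f : R :=
  if l is t :: l' then Pr s t (f s) (f t) * chain_weight t l' f else 1.

Definition path_weight l f : R :=
  if l is t :: l' then p t (f t) * chain_weight t l' f else 1.

Definition update f t b : R -> bool := fun u => if u == t then b else f u.

Lemma update_out f t b u : u != t -> update f t b u = f u.
Proof. by rewrite /update => /negbTE ->. Qed.

Lemma update_in f t b : update f t b t = b.
Proof. by rewrite /update eqxx. Qed.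

Lemma eq_chain_weight s l f g : f s = g s -> {in l, f =1 g} ->
  chain_weight s l f = chain_weight s l g.
Proof.
elim: l s => //= t l IH s fs fl.
rewrite fs fl ?mem_head// IH//; first by rewrite fl ?mem_head.
by move=> u ul; rewrite fl// inE ul orbT.
Qed.

Lemma eq_path_weight l f g : {in l, f =1 g} -> path_weight l f = path_weight l g.
Proof.
case: l => //= t l fl; rewrite fl ?mem_head//; congr (_ * _).
apply: eq_chain_weight; first by rewrite fl ?mem_head.
by move=> u ul; rewrite fl// inE ul orbT.
Qed.

Lemma chain_weight_ge0 s l f : path <%R s l -> 0 <= chain_weight s l f.
Proof.
elim: l s => //= t l IH s /andP[st tl].
by rewrite mulr_ge0 ?IH// (step_ge0 mf)// ltW.
Qed.

Lemma path_weight_ge0 l f : sorted <%R l -> 0 <= path_weight l f.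
Proof.
by case: l => //= t l tl; rewrite mulr_ge0 ?chain_weight_ge0// (law_ge0 mf).
Qed.

Lemma notin_sorted t l1 l2 : sorted <%R (l1 ++ t :: l2) -> t \notin l1 ++ l2.
Proof.
move=> /(sorted_uniq lt_trans ltxx); rewrite uniq_catC cons_uniq.
by rewrite mem_cat orbC -mem_cat => /andP[].
Qed.

(** Summing over the state at t erases t from the list, by the Chapman-
    Kolmogorov equation inside the list and by total mass one at its end. *)
Lemma chain_weight_marginal s t l1 l2 f : path <%R s (l1 ++ t :: l2) ->
  chain_weight s (l1 ++ t :: l2) (update f t false) +
  chain_weight s (l1 ++ t :: l2) (update f t true) = chain_weight s (l1 ++ l2) f.
Proof.
elim: l1 s => [|u l1 IH] s.
  move=> pl; have st : s != t by move: pl => /= /andP[/lt_eqF ->].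
  have /= := @notin_sorted t [:: s] l2 pl; rewrite inE negb_or => /andP[_ tl2].
  move: pl => /= /andP[/ltW lst pl]; rewrite !update_in !(update_out _ _ st).
  case: l2 pl tl2 => [|v l2] /=.
    by move=> _ _; rewrite !mulr1 (step_sum mf).
  move=> /andP[/ltW ltv pl]; rewrite inE negb_or => /andP[tv tl].
  have vt : v != t by rewrite eq_sym.
  rewrite !update_in !(update_out _ _ vt).
  have ext b : chain_weight v l2 (update f t b) = chain_weight v l2 f.
    apply: eq_chain_weight; first by rewrite update_out// eq_sym.
    by move=> u ul; rewrite update_out//; apply: contraNneq tl => <-.
  by rewrite !ext !mulrA -mulrDl (step_comp mf).
rewrite cat_cons => pl; move: (pl) => /= /andP[su pu].
have /= := @notin_sorted t (s :: u :: l1) l2 pl.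
rewrite !inE !negb_or eq_sym (eq_sym t u) => /and3P[st ut _].
by rewrite !(update_out _ _ st) !(update_out _ _ ut) -mulrDr IH.
Qed.

Lemma path_weight_marginal t l1 l2 f : sorted <%R (l1 ++ t :: l2) ->
  path_weight (l1 ++ t :: l2) (update f t false) +
  path_weight (l1 ++ t :: l2) (update f t true) = path_weight (l1 ++ l2) f.
Proof.
case: l1 => [|u l1] /= pl.
  rewrite !update_in; case: l2 pl => [|v l2] /=.
    by rewrite !mulr1 (law_sum mf).
  move=> /[dup] /(@notin_sorted t [::] (v :: l2)) /= tl2 /andP[/ltW ltv pl].
  move: tl2; rewrite inE negb_or => /andP[tv tl].
  have vt : v != t by rewrite eq_sym.
  rewrite !update_in !(update_out _ _ vt).
  have ext b : chain_weight v l2 (update f t b) = chain_weight v l2 f.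
    apply: eq_chain_weight; first by rewrite update_out// eq_sym.
    by move=> u ul; rewrite update_out//; apply: contraNneq tl => <-.
  by rewrite !ext !mulrA -mulrDl (law_step mf).
have /= := @notin_sorted t (u :: l1) l2 pl; rewrite inE negb_or eq_sym => /andP[ut _].
by rewrite !(update_out _ _ ut) -mulrDr chain_weight_marginal.
Qed.

Section sampling.
Variable e : nat -> R.
Hypothesis e_inj : injective e.

Definition sample_times n : seq R := sort <=%R (mkseq e n).

Lemma sorted_sample_times n : sorted <%R (sample_times n).
Proof.
by rewrite sort_lt_sorted mkseq_uniq.
Qed.

Lemma mem_sample_times n u : (u \in sample_times n) = (u \in mkseq e n).
Proof. by rewrite mem_sort. Qed.

Lemma mem_sample_times_e n i : (e i \in sample_times n) = (i < n)%N.
Proof.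
rewrite mem_sample_times; apply/mapP/idP => [[j]|ilt]; last by exists i; rewrite ?mem_iota.
by rewrite mem_iota /= add0n => jn /e_inj ->.
Qed.

(** A new time is inserted somewhere among the earlier samples, and not at
    the end of the sorted list. *)
Lemma sample_timesS n : exists l1 l2,
  sample_times n = l1 ++ l2 /\ sample_times n.+1 = l1 ++ e n :: l2.
Proof.
have en : e n \in sample_times n.+1 by rewrite mem_sample_times_e.
have := sorted_sample_times n.+1; have memS := mem_sample_times n.+1.
move: memS; case/splitPr: en => l1 l2 memS sl; exists l1, l2; split=> //.
apply: lt_sorted_eq; first exact: sorted_sample_times.
  apply: subseq_sorted sl; first exact: lt_trans.
  by rewrite cat_subseq// subseq_cons.
move=> u; have nl := notin_sorted sl.
rewrite mem_sample_times; have := memS u; rewrite mkseqS mem_rcons inE.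
rewrite mem_cat inE orbCA -mem_cat.
have [->|//] := eqVneq u (e n).
by rewrite (negbTE nl) -mem_sample_times mem_sample_times_e ltnn.
Qed.

(** The i-th letter of s is the state at time e i. The times e i come in no
    particular order. *)
Definition word_states (s : seq bool) : R -> bool :=
  fun u => nth false s (index u (mkseq e (size s))).

Lemma index_e n i : (i < n)%N -> index (e i) (mkseq e n) = i.
Proof.
move=> ilt; rewrite -{1}(nth_mkseq 0 e ilt) index_uniq ?size_mkseq//.
exact: mkseq_uniq.
Qed.

Lemma word_states_e (s : seq bool) i : (i < size s)%N -> word_states s (e i) = nth false s i.
Proof. by move=> ilt; rewrite /word_states index_e. Qed.

Lemma word_states_mkseq f n : {in sample_times n, word_states (mkseq (f \o e) n) =1 f}.
Proof.
move=> u; rewrite mem_sample_times => /mapP[i]; rewrite mem_iota add0n /= => ilt ->.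
by rewrite word_states_e ?size_mkseq// nth_mkseq.
Qed.

Definition word_weight (s : seq bool) : R := path_weight (sample_times (size s)) (word_states s).

Lemma word_weight_rcons (s : seq bool) :
  word_weight s = word_weight (rcons s false) + word_weight (rcons s true).
Proof.
set n := size s; have [l1 [l2 [e1 e2]]] := sample_timesS n.
have sl : sorted <%R (l1 ++ e n :: l2) by rewrite -e2 sorted_sample_times.
rewrite /word_weight !size_rcons -/n e1 -(path_weight_marginal (word_states s) sl) -e2.
have ext b : {in sample_times n.+1, word_states (rcons s b) =1 update (word_states s) (e n) b}.
  move=> u; rewrite mem_sample_times => /mapP[i]; rewrite mem_iota add0n /= => ilt ->.
  rewrite word_states_e ?size_rcons// nth_rcons -/n.
  move: ilt; rewrite ltnS leq_eqVlt => /predU1P[->|ilt].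
    by rewrite ltnn eqxx update_in.
  rewrite ilt update_out ?word_states_e//; apply: contraTneq ilt => /e_inj ->.
  by rewrite ltnn.
by rewrite -!(eq_path_weight (ext _)).
Qed.

Definition agree {T : Type} (X : R -> T -> bool) l f : set T :=
  [set x | {in l, forall u, X u x = f u}].

Lemma agree_nil {T : Type} (X : R -> T -> bool) f : agree X [::] f = setT.
Proof. by apply/seteqP; split. Qed.

Lemma agree_cons {T : Type} (X : R -> T -> bool) t l f :
  agree X (t :: l) f = [set x | X t x = f t] `&` agree X l f.
Proof.
apply/seteqP; split=> x /=.
  by move=> h; split=> [|u ul]; apply: h; rewrite ?mem_head// inE ul orbT.
by move=> [h1 h2] u; rewrite inE => /predU1P[->//|]; exact: h2.
Qed.

Lemma eq_agree {T : Type} (X : R -> T -> bool) l l' f f' :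
  l =i l' -> {in l, f =1 f'} -> agree X l f = agree X l' f'.
Proof.
move=> ll ff; apply/seteqP; split=> x h u ul.
  by rewrite h ?ll// ff// ll.
by rewrite h -?ll// ff.
Qed.

Lemma measurable_agree {d} {T : measurableType d} (X : R -> T -> bool) l f :
  (forall u, measurable_fun setT (X u)) -> measurable (agree X l f).
Proof.
move=> mX; elim: l => [|t l IH]; first by rewrite agree_nil.
rewrite agree_cons; apply: measurableI => //.
rewrite (_ : [set x | _] = X t @^-1` [set f t]); last by [].
by rewrite -[_ @^-1` _]setTI; exact: mX.
Qed.

(** The weights of the words that list the states at e 0, e 1, ... are
    consistent by path_weight_marginal, so binary_process realizes them. The
    law along an arbitrary increasing list follows by erasing the other
    sampled times one by one. *)
Lemma markov_skeleton : exists (d : measure_display) (T : measurableType d)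
    (P : probability T R) (X : R -> T -> bool),
  (forall u, measurable_fun setT (X u)) /\
  forall l f, sorted <%R l -> {subset l <= range e} ->
    P (agree X l f) = (path_weight l f)%:E.
Proof.
have wge (s : seq bool) : 0 <= word_weight s by rewrite path_weight_ge0// sorted_sample_times.
have [|d [T [P [xi [mxi Pxi]]]]] := binary_process _ wge word_weight_rcons.
  by rewrite /word_weight /sample_times.
pose idx (u : R) : nat := xget 0%N [set i | e i = u].
have idxK i : idx (e i) = i.
  by apply: xget_unique => // j /e_inj.
pose X (u : R) := xi (idx u).
have mX u : measurable_fun setT (X u) by exact: mxi.
exists d, T, P, X; split=> //.
have grid n f : P (agree X (sample_times n) f) = (path_weight (sample_times n) f)%:E.
  rewrite -(eq_path_weight (@word_states_mkseq f n)).
  have := Pxi n (mkseq (f \o e) n) (size_mkseq _ _).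
  rewrite /word_weight size_mkseq => <-; congr (P _).
  apply/seteqP; split=> x /=.
    move=> h; apply: (@eq_from_nth _ false); rewrite !size_mkseq// => i ilt.
    by rewrite !nth_mkseq//= -h ?mem_sample_times_e// /X idxK.
  move=> h u; rewrite mem_sample_times => /mapP[i]; rewrite mem_iota add0n /= => ilt ->.
  have := congr1 (nth false ^~ i) h; rewrite /= !nth_mkseq//= => <-.
  by rewrite /X idxK.
have drop1 t l1 l2 f : sorted <%R (l1 ++ t :: l2) ->
    (forall f, P (agree X (l1 ++ t :: l2) f) = (path_weight (l1 ++ t :: l2) f)%:E) ->
    P (agree X (l1 ++ l2) f) = (path_weight (l1 ++ l2) f)%:E.
  move=> sl h; have nt := notin_sorted sl.
  rewrite -(path_weight_marginal f sl) EFinD -!h -measureU//; last 3 first.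
  - exact: measurable_agree.
  - exact: measurable_agree.
  - apply/seteqP; split=> // x [/(_ t)] + /(_ t).
    by rewrite mem_cat mem_head orbT !update_in => -> // /(_ isT).
  congr (P _); apply/seteqP; split=> x.
    move=> hx; case Xt : (X t x); [right|left] => u;
      rewrite mem_cat inE orbCA -mem_cat => /predU1P[->|ul];
      by rewrite ?update_in// update_out ?hx//; apply: contraNneq nt => <-.
  move=> hx u ul; have ut : u != t by apply: contraNneq nt => <-.
  have ul' : u \in l1 ++ t :: l2 by rewrite mem_cat inE orbCA -mem_cat ul orbT.
  by case: hx => /(_ _ ul'); rewrite update_out.
have sub l l1 l2 : sorted <%R (l1 ++ l2) -> subseq l l2 ->
    (forall f, P (agree X (l1 ++ l2) f) = (path_weight (l1 ++ l2) f)%:E) ->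
    forall f, P (agree X (l1 ++ l) f) = (path_weight (l1 ++ l) f)%:E.
  elim: l2 l l1 => [|t l2 IH] l l1 sl; first by move=> /eqP ->.
  case: l => [|u l] /=.
    move=> _ h f; apply: (IH [::]) => //; first 2 last.
    - by move=> g; exact: drop1 sl h.
    - apply: subseq_sorted sl; first exact: lt_trans.
      by rewrite cat_subseq// subseq_cons.
    - exact: sub0seq.
  have [->|ut] := eqVneq u t.
    move=> ll h f; rewrite -cat_rcons; apply: IH => //; first by rewrite cat_rcons.
    by move=> g; rewrite cat_rcons.
  move=> lu h f; apply: IH => //; last by move=> g; exact: drop1 sl h.
  apply: subseq_sorted sl; first exact: lt_trans.
  by rewrite cat_subseq// subseq_cons.
move=> l f sl le.
have [n ln] : exists n, {subset l <= sample_times n}.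
  elim: l le {sl} => [|t l IH] le; first by exists 0%N.
  have [|n ln] := IH; first by move=> u ul; apply: le; rewrite inE ul orbT.
  have := le t (mem_head _ _); rewrite inE => -[i _ <-].
  exists (maxn n i.+1) => u; rewrite inE => /predU1P[->|].
    by rewrite mem_sample_times_e leq_max leqnn orbT.
  move=> /ln; rewrite !mem_sample_times => /mapP[j]; rewrite mem_iota add0n /= => jn ->.
  by apply: map_f; rewrite mem_iota add0n leq_max jn.
apply: (sub l [::] (sample_times n)) => //=; first exact: sorted_sample_times.
suff -> : l = [seq u <- sample_times n | u \in l] by exact: filter_subseq.
apply: lt_sorted_eq => //.
  by apply: sorted_filter; [exact: lt_trans|exact: sorted_sample_times].
by move=> u; rewrite mem_filter; case ul : (u \in l) => //=; rewrite ln.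
Qed.

End sampling.
End skeleton.

(** * The Markov property at dyadic times *)

Definition dyadic {R : realType} (k m : nat) : R := m%:R / 2 ^+ k.

Lemma dyadic_enum (R : realType) :
  exists2 e : nat -> R, injective e & forall k m, range e (dyadic k m).
Proof.
have /card_set_bijP[f [_ finj fsurj]] := card_esym card_rat.
exists (fun i => ratr (f i)) => [i j /fmorph_inj|k m].
  by apply: finj; rewrite inE.
have [i _ fi] := fsurj (m%:R / 2 ^+ k) I; exists i => //.
by rewrite fi /dyadic fmorph_div rmorphXn !rmorph_nat.
Qed.

Section discrete_markov.
Context {R : realType}.
Variables (p : R -> bool -> R) (Pr : R -> R -> bool -> bool -> R).
Hypothesis mf : markov_family p Pr.
Context {d : measure_display} {T : measurableType d} (P : probability T R).
Variables (D : set R) (X : R -> T -> bool).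
Hypothesis mX : forall u, measurable_fun setT (X u).
Hypothesis lawX : forall l f, sorted <%R l -> (forall u, u \in l -> D u) ->
  P (agree X l f) = (path_weight p Pr l f)%:E.

Lemma chain_weight_rcons s l t f : chain_weight Pr s (rcons l t) f =
  chain_weight Pr s l f * Pr (last s l) t (f (last s l)) (f t).
Proof. by elim: l s => [|u l IH] s /=; rewrite ?mulr1 ?mul1r// IH mulrA. Qed.

Lemma cylinder_agree (q : seq (R * bool)) f : {in q, forall c, f c.1 = c.2} ->
  cylinder X q = agree X (map fst q) f.
Proof.
move=> qf; apply/seteqP; split=> x h.
  by move=> _ /mapP[c cq ->]; rewrite (h _ cq) qf.
by move=> c cq; rewrite -qf//; apply: h; exact: map_f.
Qed.

Lemma cylinder_rcons q c : cylinder X (rcons q c) = cylinder X q `&` [set x | X c.1 x = c.2].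
Proof.
apply/seteqP; split=> x.
  move=> h; split; first by move=> c' cq; apply: h; rewrite mem_rcons inE cq orbT.
  by apply: h; rewrite mem_rcons mem_head.
by move=> [h1 h2] c'; rewrite mem_rcons inE => /predU1P[->//|]; exact: h1.
Qed.

(** If the past prescribes two states at the same time, both sides vanish.
    Otherwise it is the graph of a function of time, and both events can be
    read along the sorted list of its times, where s comes last. *)
Lemma discrete_markov past (s t : R) (x y : bool) : s <= t -> D s -> D t ->
  {in past, forall c, D c.1 /\ c.1 <= s} ->
  P (cylinder X (rcons (rcons past (s, x)) (t, y))) =
  (P (cylinder X (rcons past (s, x))) * (Pr s t x y)%:E)%E.
Proof.
move=> st Ds Dt hpast; set q := rcons past (s, x).
have hq : {in q, forall c, D c.1 /\ c.1 <= s}.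
  by move=> c; rewrite mem_rcons inE => /predU1P[->//|]; exact: hpast.
have sq : (s, x) \in q by rewrite mem_rcons mem_head.
have [[f qf]|nf] := pselect (exists f : R -> bool, {in q, forall c, f c.1 = c.2}); last first.
  rewrite cylinder_rcons (_ : cylinder X q = set0) ?set0I ?measure0 ?mul0e//.
  apply/seteqP; split=> // w h; apply: nf; exists (X^~ w).
  by move=> c cq; exact: h.
have fs : f s = x by rewrite (qf _ sq).
have := st; rewrite le_eqVlt => /predU1P[ts|lst].
  rewrite -ts (step_refl mf) cylinder_rcons /=.
  have [xy|xy] := eqVneq x y.
    rewrite mule1; congr (P _); rewrite setIidl// => w /(_ _ sq) /= ->.
    exact: xy.
  rewrite mule0 (_ : _ `&` _ = set0) ?measure0//.
  by apply/seteqP; split=> // w [/(_ _ sq) /= ->] => /eqP; rewrite (negbTE xy).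
set l := sort <=%R (undup (map fst q)).
have sl : sorted <%R l by rewrite sort_lt_sorted undup_uniq.
have ml : l =i map fst q by move=> u; rewrite mem_sort mem_undup.
have Dl u : u \in l -> D u by rewrite ml => /mapP[c /hq[]] + _ ->.
have lmax u : u \in l -> u <= s by rewrite ml => /mapP[c /hq[_]] + ->.
have sinl : s \in l by rewrite ml; apply/mapP; exists (s, x).
(* All times of the past are at most s, so s ends the sorted list. *)
have [a [l' [lE la]]] : exists a l', l = a :: l' /\ last a l' = s.
  move: sl sinl lmax {ml Dl}; case: l => // a l' sl sinl lmax; exists a, l'; split=> //.
  apply: le_anti; rewrite lmax ?mem_last//=.
  have /= sl' := sub_sorted (@ltW _ R) sl.
  move: sinl; rewrite inE => /predU1P[->|sin].
    by have := order_path_min le_trans sl' => /allP; 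
       case: (lastP l') => // l'' z /(_ z); rewrite last_rcons mem_rcons mem_head; apply.
  case/splitPr: sin sl' => l1 l2; rewrite cat_path last_cat /= => /and3P[_ _ sl2].
  case: (lastP l2) sl2 => // l3 z /(order_path_min le_trans)/allP/(_ z).
  by rewrite last_rcons mem_rcons mem_head; apply.
rewrite (cylinder_agree qf).
rewrite -(@eq_agree _ _ X l (map fst q) f f ml (fun _ _ => erefl)) (lawX f sl Dl).
pose f' := update f t y.
have nt c : c \in q -> c.1 != t.
  by move=> /hq[_ cs]; rewrite lt_eqF// (le_lt_trans cs).
have qf' : {in rcons q (t, y), forall c, f' c.1 = c.2}.
  move=> c; rewrite mem_rcons inE => /predU1P[->|cq] /=; first by rewrite /f' update_in.
  by rewrite /f' update_out ?qf// nt.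
rewrite (cylinder_agree qf').
have ml' : rcons l t =i map fst (rcons q (t, y)).
  by move=> u; rewrite map_rcons !mem_rcons !inE ml.
rewrite -(@eq_agree _ _ X _ _ f' f' ml' (fun _ _ => erefl)) lawX; last 2 first.
- by rewrite lE /= rcons_path la lst andbT; move: sl; rewrite lE.
- by move=> u; rewrite mem_rcons inE => /predU1P[->//|]; exact: Dl.
have ff' : {in l, f' =1 f}.
  by move=> u; rewrite ml => /mapP[c /nt ct ->]; rewrite /f' update_out.
rewrite lE /= chain_weight_rcons la -EFinM mulrA; congr (_ * _)%:E; last first.
  by rewrite /f' update_in update_out ?fs// lt_eqF.
have := eq_path_weight p Pr ff'; rewrite lE //=.
Qed.

Lemma discrete_law t y : D t -> P [set w | X t w = y] = (p t y)%:E.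
Proof.
move=> Dt; have := @lawX [:: t] (fun=> y) isT.
rewrite agree_cons agree_nil setIT /= mulr1; apply.
by move=> u; rewrite inE => /eqP ->.
Qed.

Lemma discrete_jump (C s t : R) : s < t -> D s -> D t ->
  (forall x, Pr s t x (~~ x) <= C) ->
  (P [set w | X s w != X t w] <= C%:E)%E.
Proof.
move=> st Ds Dt PC.
have Pxy x : P [set w | X s w = x /\ X t w = ~~ x] = (p s x * Pr s t x (~~ x))%:E.
  pose f := update (fun=> ~~ x) s x.
  have := @lawX [:: s; t] f; rewrite /= st /= => h.
  rewrite (_ : [set _ | _] = agree X [:: s; t] f).
    rewrite h//; last by move=> u; rewrite !inE => /orP[] /eqP ->.
    by rewrite mulr1 /f update_in update_out// gt_eqF.
  rewrite !agree_cons agree_nil setIT /f update_in update_out// gt_eqF//.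
have mset (u : R) (b : bool) : measurable [set w | X u w = b].
  rewrite (_ : [set w | _] = X u @^-1` [set b]); last by [].
  by rewrite -[_ @^-1` _]setTI; exact: mX.
rewrite (_ : [set w | _] = [set w | X s w = false /\ X t w = true] `|`
    [set w | X s w = true /\ X t w = false]); last first.
  apply/seteqP; split=> w /=; case: (X s w) (X t w) => -[] //=; by [left|right|case; case].
rewrite measureU; last 3 first.
- by apply: measurableI; exact: mset.
- by apply: measurableI; exact: mset.
- by apply/seteqP; split=> // w /= [[-> _] []].
have e1 := Pxy false; have e2 := Pxy true.
rewrite [X in (X + _)%E]e1 [X in (_ + X)%E]e2 -EFinD lee_fin.
apply: (@le_trans _ _ (p s false * C + p s true * C)).
  by rewrite lerD// ler_wpM2l// (law_ge0 mf).
by rewrite -mulrDl (law_sum mf) mul1r.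
Qed.

End discrete_markov.

(** * Jumps along dyadic grids *)

Section dyadics.
Context {R : realType}.
Local Notation dyadic := (@dyadic R).

Lemma dyadicS k m : dyadic k.+1 m.*2 = dyadic k m.
Proof.
by rewrite /dyadic -muln2 natrM exprSr -mulf_div divff ?mulr1.
Qed.

Lemma dyadicD k i m : dyadic (k + i) (m * 2 ^ i) = dyadic k m.
Proof.
elim: i => [|i IH]; first by rewrite addn0 expn0 muln1.
by rewrite addnS expnSr mulnA muln2 dyadicS IH.
Qed.

Lemma ltr_dyadic k m n : (dyadic k m < dyadic k n) = (m < n)%N.
Proof. by rewrite /dyadic ltr_pM2r ?invr_gt0 ?exprn_gt0// ltr_nat. Qed.

Lemma dyadic_ge0 k m : 0 <= dyadic k m.
Proof. by rewrite /dyadic divr_ge0// exprn_ge0. Qed.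

Lemma dyadic_whole k N : dyadic k (N * 2 ^ k) = N%:R.
Proof. by rewrite -[X in dyadic X _]add0n dyadicD /dyadic expr0 divr1. Qed.

Definition jumps (x : R -> bool) (k m n : nat) : nat :=
  (\sum_(m <= j < n) (x (dyadic k j) != x (dyadic k j.+1)))%N.

Lemma jumps_cat x k m n l : (m <= n)%N -> (n <= l)%N ->
  jumps x k m l = (jumps x k m n + jumps x k n l)%N.
Proof. by move=> mn nl; rewrite /jumps (@big_cat_nat _ _ _ n). Qed.

(** A jump over an interval of the grid is still a jump over one of its
    halves. *)
Lemma jumps_double x k m n : (m <= n)%N ->
  (jumps x k m n <= jumps x k.+1 m.*2 n.*2)%N.
Proof.
elim: n => [|n IH]; first by rewrite leqn0 => /eqP ->; rewrite /jumps !big_geq.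
rewrite leq_eqVlt => /predU1P[->|]; first by rewrite /jumps !big_geq.
rewrite ltnS => mn; rewrite /jumps doubleS.
have mn2 : (m.*2 <= n.*2)%N by rewrite leq_double.
rewrite big_nat_recr//= !big_nat_recr//=; last by rewrite (leq_trans mn2).
rewrite -addnA leq_add ?IH// -[in X in (X <= _)%N]dyadicS -[in X in (X <= _)%N](dyadicS k n.+1).
rewrite doubleS.
by case: (x _) (x _) (x _) => [] [] [].
Qed.

Lemma jumps_refine x k i m n : (m <= n)%N ->
  (jumps x k m n <= jumps x (k + i) (m * 2 ^ i) (n * 2 ^ i))%N.
Proof.
move=> mn; elim: i => [|i IH]; first by rewrite addn0 expn0 !muln1.
apply: leq_trans IH _; rewrite addnS expnSr !mulnA !muln2 jumps_double//.
by rewrite leq_mul2r mn orbT.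
Qed.

Lemma jumps_ge1 x k m n : (m <= n)%N -> x (dyadic k m) != x (dyadic k n) ->
  (0 < jumps x k m n)%N.
Proof.
elim: n => [|n IH]; first by rewrite leqn0 => /eqP ->; rewrite eqxx.
rewrite leq_eqVlt => /predU1P[->|]; first by rewrite eqxx.
rewrite ltnS => mn; rewrite (@jumps_cat _ _ _ n)// {2}/jumps big_nat1.
have [e|/(IH mn) h] := eqVneq (x (dyadic k m)) (x (dyadic k n)); last by rewrite addn_gt0 h.
by rewrite e addn_gt0 => ->; rewrite orbT.
Qed.

Definition few_jumps (x : R -> bool) : Prop :=
  forall N, exists B, forall k, (jumps x k 0 (N * 2 ^ k) <= B)%N.

Lemma nat_prop_max (S : set nat) (B : nat) : S !=set0 -> (forall n, S n -> (n <= B)%N) ->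
  exists2 n, S n & forall m, S m -> (m <= n)%N.
Proof.
move=> [n0 Sn0] SB; pose p n := `[< S n >].
have ex : exists n, p n by exists n0; apply/asboolP.
have ub n : p n -> (n <= B)%N by move=> /asboolP/SB.
case: (ex_maxnP ex ub) => n /asboolP Sn mx; exists n => // m Sm.
by apply: mx; apply/asboolP.
Qed.

(** Among the dyadic times after t, choose one that sees the largest number
    of jumps between itself and N. A dyadic time between t and this one,
    with another state, would see one more jump on a common refinement of
    the two grids. *)
Lemma few_jumps_right x (t : R) : few_jumps x -> 0 <= t ->
  exists b u, t < u /\ forall k m, t < dyadic k m < u -> x (dyadic k m) = b.
Proof.
move=> fx t0; pose N := (Num.trunc t).+1.
have tN : t < N%:R by have /andP[] := truncn_itv t0.
have [B hB] := fx N.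
pose S := [set n | exists k m, [/\ t < dyadic k m, (m <= N * 2 ^ k)%N &
   jumps x k m (N * 2 ^ k) = n]].
have [||n [k0 [m0 [tm0 m0N jn]] mx]] := @nat_prop_max S B.
- exists 0%N, 0%N, N; split; first by rewrite /dyadic expr0 divr1.
    by rewrite expn0 muln1.
  by rewrite expn0 muln1 /jumps big_geq.
- move=> n [k [m [_ mN <-]]]; apply: leq_trans (hB k).
  by rewrite (@jumps_cat x k 0 m)// leq_addl.
exists (x (dyadic k0 m0)), (dyadic k0 m0); split=> // k m /andP[tm mm0].
apply/eqP; apply: contraT => xmm.
pose K := (k + k0)%N; pose m' := (m * 2 ^ k0)%N; pose m0' := (m0 * 2 ^ k)%N.
have em : dyadic K m' = dyadic k m by rewrite dyadicD.
have em0 : dyadic K m0' = dyadic k0 m0 by rewrite /K addnC dyadicD.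
have lmm : (m' < m0')%N by rewrite -(ltr_dyadic K) em em0.
have NK : (N * 2 ^ K = N * 2 ^ k0 * 2 ^ k)%N by rewrite /K expnD mulnA mulnAC.
have m0N' : (m0' <= N * 2 ^ K)%N by rewrite NK leq_mul2r m0N orbT.
suff h : (n < jumps x K m' (N * 2 ^ K))%N.
  have := mx (jumps x K m' (N * 2 ^ K)); rewrite leqNgt h; apply.
  by exists K, m'; rewrite em; split=> //; rewrite (leq_trans (ltnW lmm)).
rewrite (@jumps_cat x K _ m0') ?(ltnW lmm)// -add1n leq_add//.
  by rewrite jumps_ge1 ?(ltnW lmm)// em em0.
by rewrite -jn NK /K addnC jumps_refine.
Qed.

(** The same argument, with the number of jumps before a dyadic time smaller
    than t. *)
Lemma few_jumps_left x (t : R) : few_jumps x -> 0 < t ->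
  exists b u, u < t /\ forall k m, u < dyadic k m < t -> x (dyadic k m) = b.
Proof.
move=> fx t0; pose N := (Num.trunc t).+1.
have tN : t < N%:R by have /andP[] := truncn_itv (ltW t0).
have [B hB] := fx N.
have dN k m : dyadic k m < t -> (m <= N * 2 ^ k)%N.
  by move=> mt; rewrite ltnW// -(ltr_dyadic k) dyadic_whole (lt_trans mt).
pose S := [set n | exists k m, dyadic k m < t /\ jumps x k 0 m = n].
have [||n [k0 [m0 [tm0 jn]] mx]] := @nat_prop_max S B.
- by exists 0%N, 0%N, 0%N; split; [rewrite /dyadic mul0r|rewrite /jumps big_geq].
- move=> n [k [m [/dN mN <-]]]; apply: leq_trans (hB k).
  by rewrite [leqRHS](@jumps_cat x k 0 m)// leq_addr.
exists (x (dyadic k0 m0)), (dyadic k0 m0); split=> // k m /andP[mm0 tm].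
apply/eqP; apply: contraT => xmm.
pose K := (k + k0)%N; pose m' := (m * 2 ^ k0)%N; pose m0' := (m0 * 2 ^ k)%N.
have em : dyadic K m' = dyadic k m by rewrite dyadicD.
have em0 : dyadic K m0' = dyadic k0 m0 by rewrite /K addnC dyadicD.
have lmm : (m0' < m')%N by rewrite -(ltr_dyadic K) em em0.
suff h : (n < jumps x K 0 m')%N.
  by have := mx (jumps x K 0 m'); rewrite leqNgt h; apply; exists K, m'; rewrite em.
rewrite (@jumps_cat x K _ m0') ?(ltnW lmm)// -addn1 leq_add//.
  by have := jumps_refine x k0 k (leq0n m0); rewrite mul0n jn addnC.
by rewrite jumps_ge1 ?(ltnW lmm)// em em0 eq_sym.
Qed.

(** The first point after t of the grid of step 2^-k. It is nondecreasing in
    t, so that it respects the order of the times of a past, and it is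
    strictly larger than t, as limits from the right require. *)
Definition grid (k : nat) (t : R) : R := dyadic k (Num.trunc (2 ^+ k * t)).+1.

Lemma grid_gt k (t : R) : 0 <= t -> t < grid k t.
Proof.
move=> t0; rewrite /grid /dyadic ltr_pdivlMr ?exprn_gt0// mulrC.
by have /andP[] := truncn_itv (mulr_ge0 (exprn_ge0 k (ler0n R 2)) t0).
Qed.

Lemma grid_le k (t : R) : 0 <= t -> grid k t <= t + (2 ^+ k)^-1.
Proof.
move=> t0; rewrite /grid /dyadic ler_pdivrMr ?exprn_gt0// mulrDl mulVf ?expf_neq0//.
rewrite -natr1 lerD2r (mulrC t).
by have /andP[] := truncn_itv (mulr_ge0 (exprn_ge0 k (ler0n R 2)) t0).
Qed.

Lemma le_grid k (s t : R) : s <= t -> grid k s <= grid k t.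
Proof.
move=> st; rewrite /grid /dyadic ler_pM2r ?invr_gt0 ?exprn_gt0// ler_nat ltnS.
by rewrite le_truncn// ler_pM2l ?exprn_gt0.
Qed.

Lemma cvg_grid (t : R) : 0 <= t -> grid k t @[k --> \oo] --> t.
Proof.
move=> t0; apply: (@squeeze_cvgr _ _ _ _ (fun=> t) (fun k => t + (2 ^+ k)^-1)).
- by near=> k; rewrite ltW ?grid_gt//= grid_le.
- exact: cvg_cst.
rewrite -[X in _ --> X]addr0; apply: cvgD; first exact: cvg_cst.
rewrite (_ : (fun k => _) = (fun k => 2^-1 ^+ k)); last by apply/funext => k; rewrite exprVn.
by apply: cvg_expr; rewrite ger0_norm// invf_lt1// ltr1n.
Unshelve. all: by end_near. Qed.

Lemma near_grid (t u : R) : 0 <= t -> t < u -> \forall k \near \oo, t < grid k t < u.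
Proof.
move=> t0 tu; near=> k; rewrite grid_gt//=; near: k.
exact: (cvgr_lt t (cvg_grid t0)).
Unshelve. all: by end_near. Qed.

End dyadics.

Lemma ae_cvg_measure {R : realType} {d} {T : measurableType d} (P : probability T R)
    (A_ : nat -> set T) (A N : set T) :
  (forall k, measurable (A_ k)) -> measurable A -> P.-negligible N ->
  (forall w, ~ N w -> \forall k \near \oo, (A_ k w <-> A w)) ->
  P (A_ k) @[k --> \oo] --> P A.
Proof.
move=> mA_ mA nN h.
have [|||||_ _] := @dominated_convergence _ T R P setT measurableT
  (fun k w => (\1_(A_ k) w)%:E) (fun w => (\1_A w)%:E) (cst 1%:E).
- by move=> k; apply/measurable_EFinP; exact: measurable_indic.
- by apply/measurable_EFinP; exact: measurable_indic.
- apply: (negligibleS _ nN) => w /= /not_implyP[_ hw]; apply: contrapT => /h near_w.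
  apply: hw; apply: cvg_near_cst; apply: filterS near_w => k Ak.
  by rewrite !indicE; congr (_%:R)%:E; congr nat_of_bool; apply/idP/idP; rewrite !inE => /Ak.
- exact: finite_measure_integrable_cst.
- by apply: aeW => w k _ /=; rewrite indicE lee_fin; case: (_ \in _); rewrite ?normr1 ?normr0.
under [X in X @ _]eq_fun do rewrite integral_indic// setIT.
by rewrite integral_indic// setIT.
Qed.

(** * Right-continuous versions *)

Lemma measurable_cylinder {R : realType} {d} {T : measurableType d}
    (Y : R -> T -> bool) q :
  (forall u, measurable_fun setT (Y u)) -> measurable (cylinder Y q).
Proof.
move=> mY; elim/last_ind: q => [|q c IH].
  by rewrite (_ : cylinder _ _ = setT)//; apply/seteqP; split.
rewrite cylinder_rcons; apply: measurableI => //.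
rewrite (_ : [set w | _] = Y c.1 @^-1` [set c.2]); last by [].
by rewrite -[_ @^-1` _]setTI; exact: mY.
Qed.

Section regularization.
Context {R : realType}.
Variables (p : R -> bool -> R) (Pr : R -> R -> bool -> bool -> R).
Hypothesis mf : markov_family p Pr.
Variable C : R.
Hypothesis rate_bound : forall s t x, s <= t -> Pr s t x (~~ x) <= C * (t - s).
Context {d : measure_display} {T : measurableType d} (P : probability T R).
Variables (D : set R) (X : R -> T -> bool).
Hypothesis D_dyadic : forall k m, D (dyadic k m).
Hypothesis mX : forall u, measurable_fun setT (X u).
Hypothesis lawX : forall l f, sorted <%R l -> (forall u, u \in l -> D u) ->
  P (agree X l f) = (path_weight p Pr l f)%:E.

Let msetX (u : R) (b : bool) : measurable [set w | X u w = b].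
Proof.
rewrite (_ : [set w | _] = X u @^-1` [set b]); last by [].
by rewrite -[_ @^-1` _]setTI; exact: mX.
Qed.

Let mjump (s t : R) : measurable [set w | X s w != X t w].
Proof.
rewrite (_ : [set w | _] = ([set w | X s w = true] `&` [set w | X t w = false]) `|`
   ([set w | X s w = false] `&` [set w | X t w = true])).
  by apply: measurableU; apply: measurableI; exact: msetX.
by apply/seteqP; split=> w /=; case: (X s w); case: (X t w) => //=;
  by [left|right|case=> -[]].
Qed.

Definition jump_count (k N : nat) (w : T) : \bar R :=
  (\sum_(0 <= j < N * 2 ^ k)
    (\1_[set w | X (dyadic k j) w != X (dyadic k j.+1) w] w)%:E)%E.

Lemma jump_countE k N w : jump_count k N w = (jumps (X^~ w) k 0 (N * 2 ^ k))%:R%:E.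
Proof.
rewrite /jump_count /jumps sumEFin natr_sum; congr EFin; apply: eq_bigr => j _.
by rewrite indicE; congr (nat_of_bool _)%:R; apply/idP/idP; rewrite inE.
Qed.

Lemma measurable_jump_count k N : measurable_fun setT (jump_count k N).
Proof.
by apply: emeasurable_sum => j; apply/measurable_EFinP; exact: measurable_indic.
Qed.

(** Each of the N 2^k steps of length 2^-k carries a jump with probability
    at most C 2^-k. *)
Lemma integral_jump_count_le k N : (\int[P]_w jump_count k N w <= (C * N%:R)%:E)%E.
Proof.
rewrite /jump_count ge0_integral_sum//=; last first.
  by move=> j; apply/measurable_EFinP; exact: measurable_indic.
apply: (@le_trans _ _ (\sum_(0 <= j < N * 2 ^ k) (C / 2 ^+ k)%:E)%E).
  apply: lee_sum => j _; rewrite integral_indic// setIT.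
  apply: (discrete_jump mf mX lawX) => //; first by rewrite ltr_dyadic.
  move=> x; apply: le_trans (rate_bound _ _) _; first by rewrite ltW// ltr_dyadic.
  by rewrite /dyadic -mulrBl -natr1 addrAC subrr add0r mul1r.
rewrite sumEFin lee_fin sumr_const_nat subn0 -[leLHS]mulr_natr natrM natrX.
by rewrite [leLHS]mulrACA mulVf ?expf_neq0// mulr1.
Qed.

Definition regular : set T := [set w | few_jumps (X^~ w)].

Lemma measurable_regular : measurable regular.
Proof.
rewrite (_ : regular = \bigcap_N \bigcup_B \bigcap_k
    (jump_count k N @^-1` [set x | x <= B%:R%:E]%E)).
  apply: bigcapT_measurable => N; apply: bigcupT_measurable => B.
  apply: bigcapT_measurable => k.
  rewrite -[_ @^-1` _]setTI.
  exact: (emeasurable_fun_infty_c measurableT (measurable_jump_count k N)).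
apply/seteqP; split=> w.
  move=> h N _; have [B hB] := h N; exists B => // k _ /=.
  by rewrite jump_countE lee_fin ler_nat.
move=> h N; have [B _ hB] := h N I; exists B => k; have /= := hB k I.
by rewrite jump_countE lee_fin ler_nat.
Qed.

(** The numbers of jumps on the grids increase with k and have bounded
    expectations. By monotone convergence their limit is integrable, hence
    finite almost surely. *)
Lemma regular_ae : P.-negligible (~` regular).
Proof.
have nN N : P.-negligible [set w | ~ exists B, forall k, (jumps (X^~ w) k 0 (N * 2 ^ k) <= B)%N].
  have nd w : nondecreasing_seq (fun k => jump_count k N w).
    apply/nondecreasing_seqP => k; rewrite !jump_countE lee_fin ler_nat.
    by rewrite expnSr mulnA muln2 -[X in jumps _ k.+1 X]double0 jumps_double.
  have c0 k w : (0 <= jump_count k N w)%E by rewrite jump_countE lee_fin.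
  have mc k := measurable_jump_count k N.
  have := @cvg_monotone_convergence _ T R P setT measurableT (fun k => jump_count k N) mc
    (fun k w _ => c0 k w) (fun w _ => nd w).
  set F := (fun w => limn _) => cF.
  have Fle : (\int[P]_w F w <= (C * N%:R)%:E)%E.
    rewrite -(cvg_lim _ cF)//; apply: lime_le; first by apply: cvgP cF.
    by apply: nearW => k; exact: integral_jump_count_le.
  have cvF w : jump_count k N w @[k --> \oo] --> F w by exact: ereal_nondecreasing_is_cvgn.
  have F0 w : (0 <= F w)%E.
    by apply: lime_ge; [exact: cvgP (cvF w)|apply: nearW => k; exact: c0].
  have mF : measurable_fun setT F.
    by apply: (@emeasurable_fun_cvg _ _ _ _ (fun k => jump_count k N)) => // w _; exact: cvF.
  have iF : P.-integrable setT F.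
    apply/integrableP; split=> //.
    rewrite (eq_integral F); last by move=> w _; rewrite gee0_abs.
    by rewrite (le_lt_trans Fle)// ltry.
  apply: (negligibleS _ (integrable_ae measurableT iF)) => w /= h fF.
  apply: h; have /fineK Fe := fF I.
  exists (Num.trunc (fine (F w))).+1 => k.
  have : (jump_count k N w <= F w)%E.
    apply: lime_ge; first exact: cvgP (cvF w).
    by near=> n; apply: nd; near: n; exact: nbhs_infty_ge.
  rewrite jump_countE -Fe lee_fin => h; rewrite -(ler_nat R) (le_trans h)//.
  have /andP[_ /ltW] : (Num.trunc (fine (F w)))%:R <= fine (F w) < (Num.trunc (fine (F w))).+1%:R.
    by apply: truncn_itv; rewrite fine_ge0.
  by [].
apply: (negligibleS _ (negligible_bigcup nN)) => w; rewrite /regular /= => h.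
apply: contrapT => h'; apply: h => N; apply: contrapT => hN; apply: h'.
by exists N.
Unshelve. all: by end_near. Qed.

(** The limit of X from the right along the grids. On the negligible set
    where this limit may not exist the path is the constant true. *)
Definition cadlag_version (t : R) (w : T) : bool :=
  `[< regular w -> \forall k \near \oo, X (grid k t) w = true >].

Lemma cadlag_version_right w t : regular w -> 0 <= t ->
  exists u, t < u /\ (forall k m, t < dyadic k m < u -> X (dyadic k m) w = cadlag_version t w) /\
    forall s, t <= s < u -> cadlag_version s w = cadlag_version t w.
Proof.
move=> gw t0; have [b [u [tu hb]]] := few_jumps_right gw t0.
have val s : t <= s < u -> cadlag_version s w = b.
  move=> /andP[ts su]; have s0 : 0 <= s by exact: le_trans ts.
  have nb : \forall k \near \oo, X (grid k s) w = b.
    near=> k; apply: hb; have /andP[h1 h2] : s < grid k s < u.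
      by near: k; exact: near_grid.
    by rewrite h2 (le_lt_trans ts).
  apply/asboolP/idP => [/(_ gw) h|bt].
    by have [k [-> ->]] := filter_ex (filterI nb h).
  by move=> _; rewrite bt in nb.
have vt : cadlag_version t w = b by apply: val; rewrite lexx.
by exists u; rewrite vt.
Unshelve. all: by end_near. Qed.

Lemma cadlag_version_left w t : regular w -> 0 < t ->
  exists b, \forall s \near t^'-, cadlag_version s w = b.
Proof.
move=> gw t0; have [b [u [ut hb]]] := few_jumps_left gw t0.
exists b; near=> s.
have st : s < t by [].
have us : Num.max u 0 < s by near: s; apply: nbhs_left_gt; rewrite gt_max ut.
move: us; rewrite gt_max => /andP[us s0].
have nb : \forall k \near \oo, X (grid k s) w = b.
  near=> k; apply: hb; have /andP[h1 h2] : s < grid k s < t.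
    by near: k; exact: near_grid (ltW s0) st.
  by rewrite h2 (lt_trans us).
apply/asboolP/idP => [/(_ gw) h|bt].
  by have [k [-> ->]] := filter_ex (filterI nb h).
by move=> _; rewrite bt in nb.
Unshelve. all: by end_near. Qed.

Lemma cadlag_version_irregular w t : ~ regular w -> cadlag_version t w = true.
Proof. by move=> gw; apply/asboolP => /gw. Qed.

Lemma near_cadlag_version w t : regular w -> 0 <= t ->
  \forall k \near \oo, X (grid k t) w = cadlag_version t w.
Proof.
move=> gw t0; have [u [tu [hX _]]] := cadlag_version_right gw t0.
by near=> k; apply: hX; near: k; exact: near_grid.
Unshelve. all: by end_near. Qed.

Lemma measurable_cadlag_version t : measurable_fun setT (cadlag_version t).
Proof.
apply: (measurable_fun_bool true); rewrite setTI.
rewrite (_ : _ @^-1` _ = ~` regular `|` (regular `&`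
   \bigcup_n \bigcap_(k in [set k | (n <= k)%N]) [set w | X (grid k t) w = true])).
  apply: measurableU; first exact: measurableC measurable_regular.
  apply: measurableI; first exact: measurable_regular.
  apply: bigcupT_measurable => n; apply: bigcap_measurable => //.
  by exists n => /=.
apply/seteqP; split=> w /=.
  move=> /asboolP h; have [gw|] := pselect (regular w); last by left.
  by right; split=> //; have [n _ hn] := h gw; exists n => // k /= nk; exact: hn.
move=> h; apply/asboolP => gw; case: h => // -[_ [n _ hn]].
by exists n.
Qed.

(** On almost every path the states at the grid points and those of the
    version agree eventually, for the finitely many times of q. *)
Lemma cadlag_cylinder (q : seq (R * bool)) : (forall c, c \in q -> 0 <= c.1) ->
  P (cylinder X [seq (grid k c.1, c.2) | c <- q]) @[k --> \oo] -->
  P (cylinder cadlag_version q).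
Proof.
move=> q0; apply: ae_cvg_measure regular_ae _.
- by move=> k; exact: measurable_cylinder.
- by apply: measurable_cylinder => u; exact: measurable_cadlag_version.
move=> w /contrapT gw.
have : \forall k \near \oo, {in q, forall c, X (grid k c.1) w = cadlag_version c.1 w}.
  elim: q q0 => [|c q IH] q0; first by near=> k.
  have nq := IH (fun c' cq => q0 c' (@mem_behead _ (c :: q) c' cq)).
  have nc := near_cadlag_version gw (q0 c (mem_head _ _)).
  apply: filterS (filterI nc nq) => k [hc hq] c'.
  by rewrite inE => /predU1P[->|/hq].
apply: filterS => k h; split.
  by move=> hX c cq; rewrite -h//; apply: (hX (grid k c.1, c.2)); exact: map_f.
by move=> hY _ /mapP[c cq ->] /=; rewrite h// hY.
Unshelve. all: by end_near. Qed.

Hypothesis p_cvg : forall (t : R) y, 0 <= t -> p (grid k t) y @[k --> \oo] --> p t y.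
Hypothesis Pr_cvg : forall (s t : R) x y, 0 <= s -> s <= t ->
  Pr (grid k s) (grid k t) x y @[k --> \oo] --> Pr s t x y.

Lemma cadlag_law (t : R) y : 0 <= t -> P [set w | cadlag_version t w = y] = (p t y)%:E.
Proof.
move=> t0; have := @cadlag_cylinder [:: (t, y)].
have e (Y : R -> T -> bool) u z : cylinder Y [:: (u, z)] = [set w | Y u w = z].
  apply/seteqP; split=> w /=; first by move=> /(_ _ (mem_head _ _)).
  by move=> h c; rewrite inE => /eqP ->.
rewrite e => h; have {}h : P (cylinder X [seq (grid k c.1, c.2) | c <- [:: (t, y)]])
    @[k --> \oo] --> P [set w | cadlag_version t w = y].
  by apply: h => c; rewrite inE => /eqP ->.
rewrite -(cvg_lim _ h)//.
rewrite (_ : (fun k => _) = (fun k => (p (grid k t) y)%:E)); last first.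
  by apply/funext => k /=; rewrite e (discrete_law lawX)//; exact: D_dyadic.
apply: (@cvg_lim (\bar R)%type) => //.
by apply: cvg_EFin; [exact: nearW|exact: p_cvg].
Qed.

Lemma cadlag_markov (past : seq (R * bool)) (s t : R) (x y : bool) : 0 <= s -> s <= t ->
  (forall c, c \in past -> 0 <= c.1 <= s) ->
  P (cylinder cadlag_version (rcons (rcons past (s, x)) (t, y))) =
  (P (cylinder cadlag_version (rcons past (s, x))) * (Pr s t x y)%:E)%E.
Proof.
move=> s0 st hpast; have t0 : 0 <= t by exact: le_trans st.
have q1 c : c \in rcons past (s, x) -> 0 <= c.1.
  by rewrite mem_rcons inE => /predU1P[->//|/hpast /andP[]].
have q2 c : c \in rcons (rcons past (s, x)) (t, y) -> 0 <= c.1.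
  by rewrite mem_rcons inE => /predU1P[->//|/q1].
have h1 := cadlag_cylinder q1; have h2 := cadlag_cylinder q2.
have h3 : P (cylinder X [seq (grid k c.1, c.2) | c <- rcons (rcons past (s, x)) (t, y)])
    @[k --> \oo] --> (P (cylinder cadlag_version (rcons past (s, x))) * (Pr s t x y)%:E)%E.
  rewrite [X in X @ _](_ : _ = (fun k =>
    P (cylinder X [seq (grid k c.1, c.2) | c <- rcons past (s, x)]) *
    (Pr (grid k s) (grid k t) x y)%:E)%E).
    apply: cvgeM => //.
      apply: mule_def_fin => //; apply: fin_num_measure.
      by apply: measurable_cylinder => u; exact: measurable_cadlag_version.
    by apply: cvg_EFin; [exact: nearW|exact: Pr_cvg].
  apply/funext => k /=; rewrite !map_rcons /=.
  apply: (@discrete_markov _ _ _ mf _ _ P D X lawX);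
    [exact: le_grid|exact: D_dyadic|exact: D_dyadic|].
  move=> _ /mapP[c /hpast/andP[c0 cs] ->] /=; split; [exact: D_dyadic|exact: le_grid].
by rewrite -(cvg_lim _ h2)// (cvg_lim _ h3).
Qed.

End regularization.

(** The finite-dimensional laws give a process on the dyadic times. Its
    paths have few jumps because the probability of a jump is at most
    proportional to the length of the step, so they have right-continuous
    versions, and the Markov property passes to the limit by continuity of
    the transition probabilities. *)
Lemma markov_chain_exists (R : realType) (rate : R -> bool -> R)
    (p : R -> bool -> R) (Pr : R -> R -> bool -> bool -> R) (C : R) :
  markov_family p Pr ->
  transition_function rate Pr ->
  (forall s t x, s <= t -> Pr s t x (~~ x) <= C * (t - s)) ->
  (forall (t : R) y, 0 <= t -> p (grid k t) y @[k --> \oo] --> p t y) ->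
  (forall (s t : R) x y, 0 <= s -> s <= t ->
    Pr (grid k s) (grid k t) x y @[k --> \oo] --> Pr s t x y) ->
  exists (d : measure_display) (T : measurableType d) (P : probability T R)
    (X : R -> T -> bool), markov_chain P X rate (p 0 true) /\
    forall t y, 0 <= t -> P [set w | X t w = y] = (p t y)%:E.
Proof.
move=> mf tf rb p_cvg Pr_cvg.
have [e einj eD] := @dyadic_enum R.
have [d [T [P [X [mX lawX]]]]] := markov_skeleton mf einj.
have {}lawX l f : sorted <%R l -> (forall u, u \in l -> range e u) ->
    P (agree X l f) = (path_weight p Pr l f)%:E.
  by move=> sl le; apply: lawX => // u /le; rewrite inE.
exists d, T, P, (cadlag_version X); split; last first.
  move=> t y t0; exact: (cadlag_law mf rb eD mX lawX p_cvg).
split.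
- by move=> t _; exact: measurable_cadlag_version.
- move=> w t t0; have [gw|bw] := pselect (regular X w); last first.
    by apply: nearW => s; rewrite !cadlag_version_irregular.
  have [u [tu [_ h]]] := cadlag_version_right gw t0.
  near=> s; apply: h; apply/andP; split; first by apply: ltW.
  by near: s; exact: nbhs_right_lt.
- move=> w t t0; have [gw|bw] := pselect (regular X w); last first.
    by exists true; apply: nearW => s; rewrite cadlag_version_irregular.
  exact: cadlag_version_left.
- exact: (cadlag_law mf rb eD mX lawX p_cvg).
- exists Pr => // past s t x y s0 st hp.
  exact: (cadlag_markov mf rb eD mX lawX Pr_cvg).
Unshelve. all: by end_near. Qed.

(** * The two-state chain driven by an orbit *)

Lemma Rintegral_derive (R : realType) (F f : R -> R) (a b : R) : a <= b ->
  continuous f -> (forall x : R, is_derive x 1 F (f x)) ->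
  \int[lebesgue_measure]_(x in `[a, b]) f x = F b - F a.
Proof.
rewrite le_eqVlt => /predU1P[<-|ab] cf dF.
  by rewrite set_itv1 Rintegral_set1 subrr.
have cF : continuous F by move=> x; exact: is_derive_continuous (dF x).
rewrite /Rintegral (continuous_FTC2 ab (F := F))//.
- exact: continuous_subspaceT.
- split; first by move=> x _; case: (dF x).
  + exact: cvg_at_right_filter (cF a).
  + exact: cvg_at_left_filter (cF b).
- by move=> x _; rewrite derive1E; case: (dF x).
Qed.

Lemma derive_expR (R : realType) (f : R -> R) (x l : R) : is_derive x 1 f l ->
  is_derive x 1 (fun y => expR (f y)) (expR (f x) * l).
Proof. by move=> df; exact: (@derive_comp _ expR f x _ _ (is_derive_expR (f x)) df). Qed.

Section two_state_chain.
Context {R : realType}.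
Variables (s : R) (a q : R -> R) (A : R).
Hypotheses (s0 : 0 < s) (aA : forall t, `|a t| <= A) (q1 : forall t, `|q t| <= 1).
Hypothesis ca : continuous a.
Hypothesis dq : forall t : R, is_derive t 1 q (a t - (2 * s + `|a t|) * q t).

(** The minimizer in the Hamilton-Jacobi equation: the positive part of the
    gain that a jump brings. *)
Definition best_control (t : R) (x : bool) : R :=
  if x then Num.max (- a t) 0 else Num.max (a t) 0.

Definition mass_one (t : R) : R := (q t + 1) / 2.

Let r0 t := s + Num.max (a t) 0.
Let r1 t := s + Num.max (- a t) 0.
Let rate t := 2 * s + `|a t|.

Let rateE t : rate t = r0 t + r1 t.
Proof.
rewrite /rate /r0 /r1; have [t0|t0] := leP 0 (a t).
  by rewrite ger0_norm// max_r ?oppr_le0//; ring.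
by rewrite ltr0_norm// max_l ?oppr_ge0 ?(ltW t0)//; ring.
Qed.

Let r0_ge0 t : 0 <= r0 t.
Proof. by rewrite addr_ge0// ?(ltW s0)// le_max lexx orbT. Qed.

Let r1_ge0 t : 0 <= r1 t.
Proof. by rewrite addr_ge0// ?(ltW s0)// le_max lexx orbT. Qed.

Let rA t : r0 t <= s + A /\ r1 t <= s + A.
Proof.
have := aA t; rewrite ler_norml => /andP[l u]; have A0 := le_trans (normr_ge0 _) (aA t).
by rewrite !lerD2l !ge_max A0 u lerNl l.
Qed.

Let continuous_max0 (f : R -> R) : continuous f -> continuous (fun t => Num.max (f t) 0).
Proof. by move=> cf t; apply: continuous_max; [exact: cf|exact: cst_continuous]. Qed.

Let cr0 : continuous r0.
Proof. by apply: continuous_add; [exact: continuous_const|exact: continuous_max0]. Qed.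

Let cr1 : continuous r1.
Proof.
apply: continuous_add; first exact: continuous_const.
by apply: continuous_max0 => t; apply: cvgN; exact: ca.
Qed.

Let crate : continuous rate.
Proof.
apply: continuous_add; first exact: continuous_const.
by apply: (@continuous_compose _ Num.norm) => //; exact: norm_continuous.
Qed.

Lemma mass_one_itv t : 0 <= mass_one t <= 1.
Proof. by have := q1 t; rewrite ler_norml /mass_one; lra. Qed.

Lemma derive_mass_one (t : R) : is_derive t 1 mass_one (r0 t - rate t * mass_one t).
Proof.
have -> : r0 t - rate t * mass_one t = (a t - (2 * s + `|a t|) * q t + 0) * 2^-1 + (q t + 1) * 0.
  rewrite /mass_one -/(rate t) rateE.
  have -> : a t = r0 t - r1 t.
    rewrite /r0 /r1; have [t0|t0] := leP 0 (a t).
      by rewrite max_r ?oppr_le0//; ring.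
    by rewrite max_l ?oppr_ge0 ?(ltW t0)//; ring.
  by field.
exact: (derive_mul (derive_add (dq t) (derive_const 1 t)) (derive_const 2^-1 t)).
Qed.

Section given_clock.
Variable L : R -> R.
Hypothesis dL : forall t : R, is_derive t 1 L (rate t).

(** The probability m of the state true solves m' = r0 - (r0 + r1) m for
    every initial state, and so does mass_one. The difference of two
    solutions decays like exp(- L) with L' = r0 + r1. *)
Definition state_transition (u t : R) (x y : bool) : R :=
  let m := mass_one t + expR (L u - L t) * (x%:R - mass_one u) in if y then m else 1 - m.

Definition state_law (t : R) (y : bool) : R := if y then mass_one t else 1 - mass_one t.

Lemma derive_state_transition (u t : R) x :
  is_derive t 1 (fun t => state_transition u t x true)
    (r0 t - rate t * state_transition u t x true).
Proof.
have de := derive_expR (derive_sub (derive_const (L u) t) (dL t)).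
have := derive_add (derive_mass_one t) (derive_mul de (derive_const (x%:R - mass_one u) t)).
move=> /is_derive_eq; apply; rewrite /state_transition; ring.
Qed.

Lemma derive_state_transition_false (u t : R) x :
  is_derive t 1 (fun t => state_transition u t x false)
    (r1 t - rate t * state_transition u t x false).
Proof.
have := derive_sub (derive_const 1 t) (derive_state_transition u t x).
by move=> /is_derive_eq; apply; rewrite /state_transition rateE; ring.
Qed.

(** The function exp(L) f is nondecreasing, since its derivative is exp(L)
    g. *)
Let decay_le (f g : R -> R) (u t : R) : u <= t ->
  (forall v : R, is_derive v 1 f (g v - rate v * f v)) -> (forall v, 0 <= g v) ->
  expR (L u - L t) * f u <= f t.
Proof.
move=> ut df g0.
have de (v : R) := derive_expR (dL v).
have h (v : R) := derive_mul (de v) (df v).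
have := derive_ge0_homo ut h => hh.
rewrite expRB mulrAC ler_pdivrMr ?expR_gt0// [leRHS]mulrC; apply: hh => v _.
have -> : expR (L v) * rate v * f v + expR (L v) * (g v - rate v * f v) = expR (L v) * g v by ring.
by rewrite mulr_ge0 ?expR_ge0.
Qed.

Lemma decayE (u t : R) : u <= t -> expR (L u - L t) * mass_one u <= mass_one t /\
  expR (L u - L t) * (1 - mass_one u) <= 1 - mass_one t.
Proof.
move=> ut; split; first exact: decay_le derive_mass_one r0_ge0.
apply: (@decay_le (fun v => 1 - mass_one v) r1) => // v.
have := derive_sub (derive_const 1 v) (derive_mass_one v).
by move=> /is_derive_eq; apply; rewrite rateE; ring.
Qed.

Lemma state_transition_ge0 (u t : R) x y : u <= t -> 0 <= state_transition u t x y.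
Proof.
move=> ut; have [h1 h2] := decayE ut; have e0 := expR_ge0 (L u - L t).
by move: h1 h2 e0; rewrite /state_transition; case: x y => [] [] /=; nra.
Qed.

Lemma two_state_family : markov_family state_law state_transition.
Proof.
split.
- move=> t y; have /andP[] := mass_one_itv t; rewrite /state_law.
  by case: y => //; rewrite subr_ge0.
- by move=> t; rewrite /state_law subrK.
- by move=> u t x y; exact: state_transition_ge0.
- by move=> u t x _; rewrite /state_transition subrK.
- move=> t x y; rewrite /state_transition subrr expR0 mul1r addrC subrK.
  by case: x y => [] []; rewrite /= ?subrr ?subr0.
- move=> u t v x y ut tv.
  have e : expR (L u - L v) = expR (L u - L t) * expR (L t - L v).
    by rewrite -expRD addrA subrK.
  by rewrite /state_transition e; case: y => /=; ring.
- move=> u t y ut; rewrite /state_law /state_transition; case: y => /=; ring.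
Qed.

Lemma state_transition_jump (u t : R) x : u <= t ->
  state_transition u t x (~~ x) <= (s + A) * (t - u).
Proof.
move=> ut.
have tu : state_transition u u x (~~ x) = 0 by rewrite (step_refl two_state_family); case: x.
have key (f g : R -> R) : f u = 0 ->
    (forall v : R, is_derive v 1 f (g v - rate v * f v)) ->
    (forall v, u <= v -> 0 <= f v) -> (forall v, g v <= s + A) -> f t <= (s + A) * (t - u).
  move=> fu df f0 gA.
  have h (v : R) := derive_sub (derive_scale (s + A) (derive_id v)) (df v).
  have := derive_ge0_homo ut h; rewrite mulr1 fu subr0 => hh.
  rewrite mulrBr -subr_ge0 addrAC subr_ge0; apply: hh => v.
  rewrite in_itv/= => /andP[uv _].
  have rv : 0 <= rate v by rewrite rateE addr_ge0.
  by have := mulr_ge0 rv (f0 v uv); have := gA v; lra.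
case: x tu => tu.
  apply: (key (fun t => state_transition u t true false) r1) => // v.
  + exact: derive_state_transition_false.
  + by move=> uv; exact: state_transition_ge0.
  + by case: (rA v).
apply: (key (fun t => state_transition u t false true) r0) => // v.
+ exact: derive_state_transition.
+ by move=> uv; exact: state_transition_ge0.
+ by case: (rA v).
Qed.

Lemma continuous_state_transition u x y : continuous (fun t => state_transition u t x y).
Proof.
move=> t; case: y; first exact: is_derive_continuous (derive_state_transition u t x).
exact: is_derive_continuous (derive_state_transition_false u t x).
Qed.

(** The forward equation is the integral of the linear differential equation
    of state_transition. *)
Lemma two_state_transition :
  transition_function (fun t x => s + best_control t x) state_transition.
Proof.
split.
- by move=> u t x y _ ut; exact: state_transition_ge0.
- by move=> u t x _ ut; rewrite big_bool /= addrC (step_sum two_state_family).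
- by move=> u x y _; apply: continuous_subspaceT; exact: continuous_state_transition.
- move=> u t x y _ ut.
  rewrite -(step_refl two_state_family u x y).
  have cT := @continuous_state_transition u x.
  case: y.
    rewrite (@eq_Rintegral _ _ R lebesgue_measure _
      (fun v => r0 v - rate v * state_transition u v x true)).
      rewrite (Rintegral_derive ut _ (fun v => derive_state_transition u v x)).
        by rewrite addrC subrK.
      by apply: continuous_sub => //; apply: continuous_mul.
    move=> v _; rewrite big_bool /generator /= rateE -/(r0 v) -/(r1 v).
    by rewrite /state_transition; ring.
  rewrite (@eq_Rintegral _ _ R lebesgue_measure _
      (fun v => r1 v - rate v * state_transition u v x false)).
    rewrite (Rintegral_derive ut _ (fun v => derive_state_transition_false u v x)).
      by rewrite addrC subrK.
    by apply: continuous_sub => //; apply: continuous_mul.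
  move=> v _; rewrite big_bool /generator /= rateE -/(r0 v) -/(r1 v).
  by rewrite /state_transition; ring.
Qed.

End given_clock.

Lemma two_state_chain_exists : exists (d : measure_display) (T : measurableType d)
  (P : probability T R) (X : R -> T -> bool),
  markov_chain P X (fun t x => s + best_control t x) (mass_one 0) /\
  forall t, 0 <= t -> P [set w | X t w = true] = (mass_one t)%:E.
Proof.
have [L _ dL] := antiderivative crate.
have cp : continuous mass_one by move=> t; exact: is_derive_continuous (derive_mass_one t).
have cL : continuous L by move=> t; exact: is_derive_continuous (dL t).
have pg (t : R) : 0 <= t -> mass_one (grid k t) @[k --> \oo] --> mass_one t.
  by move=> t0; apply: continuous_cvg; [exact: cp|exact: cvg_grid].
have Lg (t : R) : 0 <= t -> L (grid k t) @[k --> \oo] --> L t.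
  by move=> t0; apply: continuous_cvg; [exact: cL|exact: cvg_grid].
have lg (t : R) y : 0 <= t -> state_law (grid k t) y @[k --> \oo] --> state_law t y.
  move=> t0; rewrite /state_law; case: y; first exact: pg.
  by apply: cvgB; [exact: cvg_cst|exact: pg].
have tg (u t : R) x y : 0 <= u -> u <= t ->
    state_transition L (grid k u) (grid k t) x y @[k --> \oo] --> state_transition L u t x y.
  move=> u0 ut; have t0 := le_trans u0 ut; rewrite /state_transition.
  have m : mass_one (grid k t) + expR (L (grid k u) - L (grid k t)) *
      (x%:R - mass_one (grid k u)) @[k --> \oo] -->
      mass_one t + expR (L u - L t) * (x%:R - mass_one u).
    apply: cvgD; first exact: pg.
    apply: cvgM; last by apply: cvgB; [exact: cvg_cst|exact: pg].
    apply: continuous_cvg; first exact: continuous_expR.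
    by apply: cvgB; exact: Lg.
  by case: y => //; apply: cvgB; [exact: cvg_cst|exact: m].
have [d [T [P [X [mc lX]]]]] := markov_chain_exists (two_state_family dL)
  (two_state_transition dL) (state_transition_jump dL) lg tg.
by exists d, T, P, X; split=> // t t0; rewrite lX.
Qed.

End two_state_chain.

(** * Expected occupation of the states *)

Section joint_measurability.
Context {R : realType} {d : measure_display} {T : measurableType d}.
Variables (P : probability T R) (Y : R -> T -> bool).
Hypothesis mY : forall t, 0 <= t -> measurable_fun setT (Y t).
Hypothesis rY : forall w t, 0 <= t -> \forall s \near t^'+, Y s w = Y t w.

Lemma near_grid_right w (t : R) : 0 <= t -> \forall k \near \oo, Y (grid k t) w = Y t w.
Proof.
move=> t0; have h := rY w t0.
have : \forall k \near \oo, t < grid k t -> Y (grid k t) w = Y t w by exact: (cvg_grid t0 h).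
by apply: filterS => k; apply; exact: grid_gt.
Qed.

Let msetY (t : R) (b : bool) : 0 <= t -> measurable [set w | Y t w = b].
Proof.
move=> t0; rewrite (_ : [set w | _] = Y t @^-1` [set b]); last by [].
by rewrite -[_ @^-1` _]setTI; exact: mY.
Qed.

Definition sojourn (b : bool) : set (T * R) := [set z | 0 <= z.2 /\ Y z.2 z.1 = b].

Lemma truncn_dyadic k m (t : R) : 0 <= t ->
  (Num.trunc (2 ^+ k * t) == m) = (dyadic k m <= t < dyadic k m.+1).
Proof.
move=> t0; have k0 : 0 < 2 ^+ k :> R by rewrite exprn_gt0.
rewrite /dyadic ler_pdivrMr// ltr_pdivlMr// mulrC.
apply/eqP/idP => [<-|/truncn_def//].
by apply: truncn_itv; rewrite mulr_ge0// ltW.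
Qed.

(** By right-continuity Y is the limit of the processes that look at the
    next grid point, and for these the set is a countable union of
    rectangles. *)
Lemma measurable_sojourn b : measurable (sojourn b).
Proof.
pose A k : set (T * R) := \bigcup_m
  ([set w | Y (dyadic k m.+1) w = b] `*` `[dyadic k m, dyadic k m.+1[%classic).
have AE k z : 0 <= z.2 -> A k z <-> Y (grid k z.2) z.1 = b.
  case: z => w t /= t0; rewrite /A /grid; split.
    move=> [m _ [/= h]]; rewrite in_itv/= -truncn_dyadic// => /eqP ->.
    exact: h.
  move=> h; exists (Num.trunc (2 ^+ k * t)) => //; split=> //=.
  by rewrite in_itv/= -truncn_dyadic.
rewrite (_ : sojourn b = [set z | 0 <= z.2] `&`
   \bigcup_n \bigcap_(k in [set k | (n <= k)%N]) A k).
  apply: measurableI.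
    rewrite (_ : [set z | _] = setT `*` `[0, +oo[%classic).
      by apply: measurableX.
    by apply/seteqP; split=> z /=; rewrite in_itv/= andbT; [split|case].
  apply: bigcupT_measurable => n; apply: bigcap_measurable; first by exists n => /=.
  move=> k _; apply: bigcupT_measurable => m; apply: measurableX => //.
  by apply: msetY; exact: dyadic_ge0.
apply/seteqP; split=> -[w t] /=.
  move=> [t0 Yb]; split=> //; have [n _ hn] := near_grid_right w t0.
  by exists n => // k /= nk; apply/AE => //=; rewrite hn.
move=> [t0 [n _ hn]]; split=> //=.
have := near_grid_right w t0 => -[n' _ hn'].
have : A (maxn n n') (w, t) by apply: hn; rewrite /= leq_maxl.
by move=> /(AE _ (w, t) t0) /= <-; rewrite hn'//=; exact: leq_maxr.
Qed.

Lemma expected_occupation (S : R) (f : R -> bool -> R) :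
  (forall x, measurable_fun `[0, S] (f^~ x)) ->
  (forall t x, 0 <= t <= S -> 0 <= f t x) ->
  (\int[P]_w \int[lebesgue_measure]_(t in `[0%R, S]) (f t (Y t w))%:E =
   \int[lebesgue_measure]_(t in `[0%R, S])
     ((f t true)%:E * P [set w | Y t w = true] +
      (f t false)%:E * P [set w | Y t w = false]))%E.
Proof.
move=> mf f0.
pose D : set R := `[0, S]%classic.
have D0 t : D t -> 0 <= t by rewrite /D /= in_itv/= => /andP[].
pose g (x : bool) : R -> R := (f^~ x) \_ D.
have gE x t : D t -> g x t = f t x by move=> Dt; rewrite /g patchE mem_set.
have gN x t : ~ D t -> g x t = 0 by move=> Dt; rewrite /g patchE memNset.
have mg x : measurable_fun setT (g x).
  have mD : measurable D by exact: measurable_itv.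
  exact: ((measurable_restrictT (f^~ x) mD).1 (mf x)).
have g0 x t : 0 <= g x t.
  have [Dt|Dt] := pselect (D t); last by rewrite gN.
  by rewrite gE// f0//; move: Dt; rewrite /D /= in_itv.
pose F (z : T * R) : \bar R :=
  ((g true z.2 * \1_(sojourn true) z)%:E + (g false z.2 * \1_(sojourn false) z)%:E)%E.
have mF : measurable_fun setT F.
  have h x : measurable_fun setT (fun z : T * R => (g x z.2 * \1_(sojourn x) z)%:E).
    apply/measurable_EFinP; apply: measurable_funM.
      by apply: (measurableT_comp (mg x)); exact: measurable_snd.
    by apply: measurable_indic; exact: measurable_sojourn.
  exact: emeasurable_funD.
have F0 z : (0 <= F z)%E.
  by rewrite adde_ge0// lee_fin mulr_ge0// ?g0// indicE ler0n.
have sE x w t : 0 <= t -> \1_(sojourn x) (w, t) = (Y t w == x)%:R :> R.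
  move=> t0; rewrite indicE; congr (nat_of_bool _)%:R.
  by apply/idP/eqP; rewrite inE /sojourn /=; [case|split].
have FE w t : D t -> F (w, t) = (f t (Y t w))%:E.
  move=> Dt; rewrite /F /= !sE ?D0// !gE//.
  by case: (Y t w); rewrite /= ?mulr0 ?mulr1 ?adde0 ?add0e.
have FN w t : ~ D t -> F (w, t) = 0%E.
  by move=> Dt; rewrite /F /= !gN// !mul0r adde0.
transitivity (\int[P]_w \int[lebesgue_measure]_t F (w, t))%E.
  apply: eq_integral => w _; rewrite [LHS]integral_mkcond; apply: eq_integral => t _.
  rewrite patchE; case: ifPn => [/set_mem Dt|/negP Dt]; first by rewrite FE.
  by rewrite FN// => /mem_set.
rewrite (fubini_tonelli (m1 := P) (m2 := lebesgue_measure) F mF F0).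
rewrite [RHS]integral_mkcond; apply: eq_integral => t _.
rewrite patchE; case: ifPn => [/set_mem Dt|/negP Dt]; last first.
  rewrite (eq_integral (cst 0%E)) ?integral0// => w _ /=.
  by rewrite FN// => /mem_set.
have t0 := D0 _ Dt.
have ind x : (\int[P]_w (g x t * \1_(sojourn x) (w, t))%:E = (f t x)%:E * P [set w | Y t w = x])%E.
  rewrite gE//; under eq_integral do rewrite EFinM.
  have mi : measurable [set w | Y t w = x] by exact: msetY.
  rewrite ge0_integralZl//.
  - rewrite -[in RHS](setIT [set w | Y t w = x]) -integral_indic//.
    congr (_ * _)%E; apply: eq_integral => w _; rewrite sE// indicE.
    by congr (nat_of_bool _)%:R%:E; apply/eqP/idP; rewrite inE.
  - apply/measurable_EFinP; rewrite (_ : (fun w => _) = \1_[set w | Y t w = x]).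
      exact: measurable_indic.
    apply/funext => w; rewrite sE// indicE.
    by congr (nat_of_bool _)%:R; apply/eqP/idP; rewrite inE.
  - by rewrite lee_fin f0//; move: Dt; rewrite /D /= in_itv.
have mi x : measurable_fun setT (fun w => (g x t * \1_(sojourn x) (w, t))%:E).
  apply/measurable_EFinP; apply: measurable_funM => //.
  rewrite (_ : (fun w => _) = \1_[set w | Y t w = x]).
    by apply: measurable_indic; exact: msetY.
  apply/funext => w; rewrite sE// indicE.
  by congr (nat_of_bool _)%:R; apply/eqP/idP; rewrite inE.
rewrite ge0_integralD//=.
- by rewrite !ind.
- by move=> w _; rewrite lee_fin mulr_ge0// indicE.
- by move=> w _; rewrite lee_fin mulr_ge0// indicE.
Qed.

End joint_measurability.

(** * Integration by parts for absolutely continuous functions *)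

Section absolutely_continuous.
Context {R : realType}.
Local Notation mu := (@lebesgue_measure R).

Lemma EFin_Rintegral (A : set R) (f : R -> R) : measurable A ->
  mu.-integrable A (EFin \o f) ->
  (\int[mu]_(x in A) (f x)%:E = (\int[mu]_(x in A) f x)%R%:E)%E.
Proof. by move=> mA fi; rewrite /Rintegral fineK//; exact: integrable_fin_num. Qed.

Lemma integrable_scale (A : set R) (c : R) (f : R -> R) : measurable A ->
  mu.-integrable A (EFin \o f) -> mu.-integrable A (EFin \o (fun t => c * f t)).
Proof.
by move=> mA fi; exact: (@integrableZl _ _ _ mu _ mA c _ fi).
Qed.

Lemma integrable_add (A : set R) (f g : R -> R) : measurable A ->
  mu.-integrable A (EFin \o f) -> mu.-integrable A (EFin \o g) ->
  mu.-integrable A (EFin \o (fun t => f t + g t)).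
Proof. by move=> mA fi gi; exact: (@integrableD _ _ _ mu _ mA _ _ fi gi). Qed.

Lemma integrable_sub (A : set R) (f g : R -> R) : measurable A ->
  mu.-integrable A (EFin \o f) -> mu.-integrable A (EFin \o g) ->
  mu.-integrable A (EFin \o (fun t => f t - g t)).
Proof. by move=> mA fi gi; exact: (@integrableB _ _ _ mu _ mA _ _ fi gi). Qed.

Lemma within_integrable (S : R) (f : R -> R) : {within `[0, S], continuous f} ->
  mu.-integrable `[0, S] (EFin \o f).
Proof. by apply: continuous_compact_integrable; exact: segment_compact. Qed.

Lemma within_bounded (S : R) (f : R -> R) : {within `[0, S], continuous f} ->
  [bounded f x | x in `[0, S]%classic].
Proof.
move=> cf; have := compact_bounded (continuous_compact cf (@segment_compact R 0 S)).
move=> [M [Mr hM]]; exists M; split=> // y My x Sx; apply: (hM _ My).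
by exists x.
Qed.

Lemma integrable_within_mul (S : R) (f r : R -> R) : {within `[0, S], continuous f} ->
  mu.-integrable `[0, S] (EFin \o r) ->
  mu.-integrable `[0, S] (EFin \o (fun t => f t * r t)).
Proof.
move=> cf ir; apply: (@integrableMr _ _ R mu _ _ f (EFin \o r)) => //.
  by apply: subspace_continuous_measurable_fun.
exact: within_bounded.
Qed.

(** The function M is only absolutely continuous. The product of D' with the
    integral of r up to t is the integral of a function of (t, u) over the
    triangle 0 <= u <= t <= S, and Fubini's theorem exchanges t and u. *)
Lemma integration_by_parts_ac (S : R) (M r D D' : R -> R) : 0 <= S ->
  {within `[0, S], continuous M} -> mu.-integrable `[0, S] (EFin \o r) ->
  (forall t, 0 <= t <= S -> M t = M 0 + \int[mu]_(u in `[0, t]) r u) ->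
  continuous D' -> (forall t : R, is_derive t 1 D (D' t)) ->
  \int[mu]_(t in `[0, S]) (D' t * M t + D t * r t) = D S * M S - D 0 * M 0.
Proof.
move=> S0 cM ir Mr cD' dD.
have cD : continuous D by move=> t; exact: is_derive_continuous (dD t).
pose I : set R := `[0, S]%classic.
have mI : measurable I by exact: measurable_itv.
pose tri : set (R * R) := [set z | 0 <= z.2 /\ z.2 <= z.1 /\ z.1 <= S].
have mtri : measurable tri.
  rewrite (_ : tri = (fun z : R * R => z.2) @^-1` `[0, +oo[%classic `&`
     ((fun z : R * R => z.1 - z.2) @^-1` `[0, +oo[%classic `&`
      (fun z : R * R => z.1) @^-1` `]-oo, S]%classic)).
    apply: measurableI; last apply: measurableI.
    - by rewrite -[_ @^-1` _]setTI; apply: measurable_snd.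
    - rewrite -[_ @^-1` _]setTI; apply: measurable_funB => //.
    - by rewrite -[_ @^-1` _]setTI; apply: measurable_fst.
  by apply/seteqP; split=> z /=; rewrite !in_itv/= !andbT subr_ge0.
pose rI : R -> R := r \_ I.
pose dI : R -> R := D' \_ I.
have mr : measurable_fun I r by move/measurable_int: ir => /measurable_EFinP.
have mrI : measurable_fun setT rI by exact: ((measurable_restrictT r mI).1 mr).
have mD' : measurable_fun setT D' by exact: continuous_measurable_fun.
have mdI : measurable_fun setT dI.
  by apply: ((measurable_restrictT D' mI).1); apply: measurable_funTS.
pose f (z : R * R) : \bar R := (dI z.1 * rI z.2 * \1_tri z)%:E.
have mf : measurable_fun setT f.
  apply/measurable_EFinP; apply: measurable_funM; last exact: measurable_indic.
  apply: measurable_funM.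
    by apply: (measurableT_comp mdI); exact: measurable_fst.
  by apply: (measurableT_comp mrI); exact: measurable_snd.
have dIE t : I t -> dI t = D' t by move=> It; rewrite /dI patchE mem_set.
have dIN t : ~ I t -> dI t = 0 by move=> It; rewrite /dI patchE memNset.
have rIE t : I t -> rI t = r t by move=> It; rewrite /rI patchE mem_set.
have rIN t : ~ I t -> rI t = 0 by move=> It; rewrite /rI patchE memNset.
have [B B0 hB] : exists2 B : R, 0 <= B & forall t, `|dI t| <= B * \1_I t.
  have [B [_ hB]] := within_bounded (continuous_subspaceT cD' : {within `[0, S], continuous D'}).
  exists (`|B| + 1); first by rewrite addr_ge0.
  move=> t; have [It|It] := pselect (I t); last first.
    by rewrite dIN// normr0 mulr_ge0 ?addr_ge0// indicE.
  rewrite dIE// indicE mem_set// mulr1; apply: hB => //.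
  by rewrite (le_lt_trans (ler_norm B))// ltrDl.
have ir' : (\int[mu]_(x in I) `|(r x)%:E| < +oo)%E by move/integrableP: ir => [].
have irI : (\int[mu]_x `|(rI x)%:E| = \int[mu]_(x in I) `|(r x)%:E|)%E.
  rewrite [RHS]integral_mkcond; apply: eq_integral => x _; rewrite patchE.
  by case: ifPn => [/set_mem Ix|/negP Ix]; [rewrite rIE|rewrite rIN ?abse0// => /mem_set].
have mabs : measurable_fun setT (fun x => `|(rI x)%:E|)%E.
  by apply: measurableT_comp => //; exact/measurable_EFinP.
(* D' is bounded by B on [0, S] and r is integrable there, so the product is
   integrable on the triangle. *)
have intf : (mu \x mu)%E.-integrable setT f.
  apply: ((@integrable12ltyP _ _ _ _ R mu mu f mf).2).
  apply: (@le_lt_trans _ _ (\int[mu]_t ((B * \1_I t)%:E *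
     \int[mu]_(x in I) `|(r x)%:E|))%E).
    apply: ge0_le_integral => //.
    - by move=> t _; apply: integral_ge0.
    - have maf : measurable_fun setT (abse \o f) by exact: measurableT_comp.
      exact: (measurable_fun_fubini_tonelli_F (m2 := mu) (abse \o f) maf
        (fun z => abse_ge0 _)).
    - apply: emeasurable_funM; last exact: measurable_cst.
      apply/measurable_EFinP; apply: measurable_funM => //; exact: measurable_indic.
    - move=> t _; rewrite -irI -ge0_integralZl//; last by rewrite lee_fin mulr_ge0.
      apply: ge0_le_integral => //.
      + apply: measurableT_comp => //; apply: measurableT_comp mf _ => //.
      + by apply: emeasurable_funM => //; exact: measurable_cst.
      + move=> u _; rewrite /f /= -EFinM lee_fin !normrM.
        apply: (@le_trans _ _ (`|dI t| * `|rI u|)).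
          by rewrite ler_piMr ?mulr_ge0// indicE; case: (_ \in _); rewrite ?normr1 ?normr0.
        by rewrite ler_wpM2r.
  rewrite ge0_integralZr//; last 3 first.
  - apply/measurable_EFinP; apply: measurable_funM => //; exact: measurable_indic.
  - by move=> t _; rewrite lee_fin mulr_ge0.
  - exact: integral_ge0.
  rewrite lte_mul_pinfty//; first by apply: integral_ge0 => t _; rewrite lee_fin mulr_ge0.
  under eq_integral do rewrite EFinM.
  rewrite ge0_integralZl//; last exact/measurable_EFinP/measurable_indic.
  rewrite integral_indic// setIT.
  have muI : (mu I < +oo)%E.
    rewrite /I lebesgue_measure_itv/=.
    by case: ifP => _; rewrite ?ltry// -EFinB ltry.
  by rewrite fin_numM// ge0_fin_numE.
have := Fubini intf.
have -> : (\int[mu]_t \int[mu]_u f (t, u) =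
    (\int[mu]_(t in `[0, S]) (D' t * (M t - M 0)))%R%:E)%E.
  rewrite -EFin_Rintegral//; last first.
    apply: within_integrable => t; apply: cvgM; first exact: (continuous_subspaceT cD').
    by apply: cvgB; [exact: cM|exact: cvg_cst].
  rewrite [RHS]integral_mkcond; apply: eq_integral => t _; rewrite patchE.
  case: ifPn => [/set_mem It|/negP It]; last first.
    rewrite (eq_integral (cst 0%E)) ?integral0// => u _.
    by rewrite /f /= dIN ?mul0r// => /mem_set.
  have /andP[t0 tS] : 0 <= t <= S by move: It; rewrite /= in_itv.
  have irt : mu.-integrable `[0, t] (EFin \o r).
    by apply: integrableS ir => //; apply: subset_itvl; rewrite bnd_simp.
  rewrite Mr ?t0// addrAC subrr add0r -RintegralZl// -EFin_Rintegral//; last first.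
    exact: integrable_scale.
  rewrite [RHS]integral_mkcond; apply: eq_integral => u _; rewrite patchE.
  rewrite /f /= dIE// indicE; case: ifPn => [/set_mem|/negP] ut.
    have /andP[u0 ult] : 0 <= u <= t by move: ut; rewrite /= in_itv.
    have Iu : I u by rewrite /I /= in_itv/= u0 (le_trans ult).
    have -> : ((t, u) \in tri) = true by apply: mem_set.
    by rewrite mulr1 rIE.
  rewrite memNset ?mulr0// => -[/= u0 [ult _]]; apply: ut.
  by apply: mem_set; rewrite /= in_itv/= u0.
have -> : (\int[mu]_u \int[mu]_t f (t, u) =
    (\int[mu]_(u in `[0, S]) ((D S - D u) * r u))%R%:E)%E.
  rewrite -EFin_Rintegral//; last first.
    apply: integrable_within_mul => //; apply: continuous_subspaceT.
    by apply: continuous_sub => //; exact: continuous_const.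
  rewrite [RHS]integral_mkcond; apply: eq_integral => u _; rewrite patchE.
  case: ifPn => [/set_mem Iu|/negP Iu]; last first.
    rewrite (eq_integral (cst 0%E)) ?integral0// => t _.
    by rewrite /f /= rIN ?mulr0 ?mul0r// => /mem_set.
  have /andP[u0 uS] : 0 <= u <= S by move: Iu; rewrite /= in_itv.
  have iD' : mu.-integrable `[u, S] (EFin \o D').
    apply: continuous_compact_integrable; first exact: segment_compact.
    exact: continuous_subspaceT.
  rewrite -(Rintegral_derive uS cD' dD) mulrC -RintegralZl// -EFin_Rintegral//; last first.
    exact: integrable_scale.
  rewrite [RHS]integral_mkcond; apply: eq_integral => t _; rewrite patchE.
  rewrite /f /= rIE// indicE (mulrC (dI t)); case: ifPn => [/set_mem|/negP] tu.
    have /andP[ut tS] : u <= t <= S by move: tu; rewrite /= in_itv.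
    have It : I t by rewrite /I /= in_itv/= tS (le_trans u0).
    have -> : ((t, u) \in tri) = true by apply: mem_set.
    by rewrite mulr1 dIE.
  rewrite memNset ?mulr0// => -[/= _ [ut tS]]; apply: tu.
  by apply: mem_set; rewrite /= in_itv/= ut.
move=> [fub].
have iD'M : mu.-integrable `[0, S] (EFin \o (fun t => D' t * M t)).
  apply: within_integrable => t; apply: cvgM; last exact: cM.
  exact: (continuous_subspaceT cD').
have iDr : mu.-integrable `[0, S] (EFin \o (fun t => D t * r t)).
  by apply: integrable_within_mul => //; exact: continuous_subspaceT.
have iD' : mu.-integrable `[0, S] (EFin \o D').
  by apply: within_integrable; exact: continuous_subspaceT.
have iMD' : mu.-integrable `[0, S] (EFin \o (fun t => M 0 * D' t)) by exact: integrable_scale.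
have iDSr : mu.-integrable `[0, S] (EFin \o (fun t => D S * r t)) by exact: integrable_scale.
rewrite RintegralD//.
have e1 : \int[mu]_(t in `[0, S]) (D' t * (M t - M 0)) =
    \int[mu]_(t in `[0, S]) (D' t * M t) - M 0 * (D S - D 0).
  rewrite -(Rintegral_derive S0 cD' dD) -RintegralZl// -RintegralB//.
  by apply: eq_Rintegral => t _; ring.
have e2 : \int[mu]_(t in `[0, S]) ((D S - D t) * r t) =
    D S * \int[mu]_(t in `[0, S]) r t - \int[mu]_(t in `[0, S]) (D t * r t).
  rewrite -RintegralZl// -RintegralB//.
  by apply: eq_Rintegral => t _; ring.
have MS : M S = M 0 + \int[mu]_(u in `[0, S]) r u by rewrite Mr// S0 lexx.
move: fub; rewrite e1 e2 MS => /(canRL (subrK _)) ->; ring.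
Qed.

End absolutely_continuous.

(** * Verification of optimality *)

Section chain_law.
Context {R : realType}.
Local Notation mu := (@lebesgue_measure R).

Definition net_flow (s : R) (beta : R -> bool -> R) (M : R -> R) (u : R) : R :=
  (1 - M u) * (s + beta u false) - M u * (s + beta u true).

Lemma integrable_net_flow (s S : R) beta M : admissible beta -> 0 <= S ->
  {within `[0, S], continuous M} ->
  mu.-integrable `[0, S] (EFin \o net_flow s beta M).
Proof.
move=> [_ ib] S0 cM.
have isb x : mu.-integrable `[0, S] (EFin \o (fun u => s + beta u x)).
  apply: (integrable_add (f := fun=> s)) => //; last exact: ib.
  by apply: (@within_integrable _ S (fun=> s)); apply: continuous_subspaceT; exact: cst_continuous.
apply: integrable_sub => //; last exact: integrable_within_mul.
apply: integrable_within_mul => // u; apply: cvgB; [exact: cvg_cst|exact: cM].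
Qed.

(** The Markov property from time 0 expresses the law of Y t by the
    transition probabilities, whose forward equations combine linearly into
    M' = net_flow. *)
Lemma chain_law (s p0 : R) beta {d : measure_display} {T : measurableType d}
    (P : probability T R) (Y : R -> T -> bool) :
  admissible beta -> markov_chain P Y (fun t x => s + beta t x) p0 ->
  exists M : R -> R, [/\
    forall t, 0 <= t -> P [set w | Y t w = true] = (M t)%:E /\
      P [set w | Y t w = false] = (1 - M t)%:E,
    forall t, 0 <= t -> 0 <= M t <= 1,
    forall S, {within `[0, S], continuous M} &
    forall t, 0 <= t -> M t = M 0 + \int[mu]_(u in `[0, t]) net_flow s beta M u].
Proof.
move=> ab [mY rY _ Y0 [Pr tf mk]].
have mset (t : R) b : 0 <= t -> measurable [set w | Y t w = b].
  move=> t0; rewrite (_ : [set w | _] = Y t @^-1` [set b]); last by [].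
  by rewrite -[_ @^-1` _]setTI; exact: mY.
have setCE t : [set w | Y t w = false] = ~` [set w | Y t w = true].
  by apply/seteqP; split=> w /=; case: (Y t w).
pose p_ (x : bool) := if x then p0 else 1 - p0.
have P0 x : P [set w | Y 0 w = x] = (p_ x)%:E.
  case: x => //=; rewrite setCE probability_setC ?Y0//; exact: mset.
pose M t := p0 * Pr 0 t true true + (1 - p0) * Pr 0 t false true.
have PM t : 0 <= t -> P [set w | Y t w = true] = (M t)%:E.
  move=> t0; have joint x : P [set w | Y 0 w = x /\ Y t w = true] = (p_ x * Pr 0 t x true)%:E.
    have := mk [::] 0 t x true (lexx _) t0 (fun c (h : c \in [::]) => False_ind _ (notF h)).
    rewrite (_ : cylinder _ _ = [set w | Y 0 w = x /\ Y t w = true]); last first.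
      by rewrite !cylinder_rcons; apply/seteqP; split=> w /=; [case=> [[_]]|case].
    rewrite (_ : cylinder _ _ = [set w | Y 0 w = x]); last first.
      by rewrite !cylinder_rcons; apply/seteqP; split=> w /=; [case|].
    by rewrite P0 EFinM.
  rewrite (_ : [set w | _] = [set w | Y 0 w = true /\ Y t w = true] `|`
      [set w | Y 0 w = false /\ Y t w = true]); last first.
    apply/seteqP; split=> w /=; last by case; case.
    by move=> ->; case: (Y 0 w); [left|right].
  rewrite measureU; last 3 first.
  - by apply: measurableI; exact: mset.
  - by apply: measurableI; exact: mset.
  - by apply/seteqP; split=> // w /= [[-> _] []].
  have e1 := joint true; have e2 := joint false.
  by rewrite [X in (X + _)%E]e1 [X in (_ + X)%E]e2 -EFinD.
have cP x S : {within `[0, S], continuous (fun t => Pr 0 t x true)}.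
  have sub : ([set` `[0, S]] : set R) `<=` [set` `[0, +oo[].
    by apply: subset_itvl; rewrite bnd_simp.
  exact: continuous_subspaceW sub (@transition_continuous _ _ _ tf 0 x true (lexx 0)).
have cM S : {within `[0, S], continuous M}.
  by move=> t; apply: cvgD; apply: cvgMr; exact: cP.
have fwd x t : 0 <= t -> Pr 0 t x true =
    x%:R + \int[mu]_(u in `[0, t]) net_flow s beta (fun u => Pr 0 u x true) u.
  move=> t0; rewrite (@transition_forward _ _ _ tf 0 t x true (lexx 0) t0) eqb_id; congr (_ + _).
  apply: eq_Rintegral => u; rewrite inE/= in_itv/= => /andP[u0 _].
  have := @transition_sum1 _ _ _ tf 0 u x (lexx 0) u0.
  rewrite !big_bool /generator /net_flow /= => su.
  have -> : Pr 0 u x false = 1 - Pr 0 u x true by rewrite -su addrAC subrr add0r.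
  by ring.
exists M; split=> //.
- move=> t t0; split; first exact: PM.
  by rewrite setCE probability_setC ?PM//; exact: mset.
- move=> t t0; rewrite -!lee_fin -PM// probability_le1 ?andbT//; exact: mset.
have Mf t : 0 <= t -> M t = p0 + \int[mu]_(u in `[0, t]) net_flow s beta M u.
  move=> t0; rewrite /M (fwd true)// (fwd false)//.
  have i1 := integrable_net_flow s ab t0 (cP true t).
  have i2 := integrable_net_flow s ab t0 (cP false t).
  rewrite !mulrDr mulr1 mulr0 add0r -addrA; congr (_ + _).
  rewrite -!RintegralZl// -RintegralD//; last 2 first.
  - exact: integrable_scale.
  - exact: integrable_scale.
  by apply: eq_Rintegral => u _; rewrite /net_flow; ring.
move=> t t0; rewrite [LHS]Mf// [in RHS]Mf//.
by rewrite set_itv1 Rintegral_set1 addr0.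
Qed.

End chain_law.

Section verification.
Context {R : realType}.
Local Notation mu := (@lebesgue_measure R).
Variables (s kappa A : R) (a q : R -> R).
Hypotheses (s0 : 0 < s) (kappa0 : 0 < kappa).
Hypothesis da : forall t : R, is_derive t 1 a (drift s (a t) - kappa * q t).
Hypothesis dq : forall t : R, is_derive t 1 q (a t - (2 * s + `|a t|) * q t).
Hypotheses (aA : forall t, `|a t| <= A) (q1 : forall t, `|q t| <= 1).

Local Notation p := (mass_one q).

(** By the Hamilton-Jacobi equation of the control problem, the value of the
    state 0 decreases at this rate up to a constant, and the value of the
    state 1 is smaller by a. *)
Definition value_rate (t : R) : R :=
  kappa * p t - s * a t - 2^-1 * Num.max (a t) 0 ^+ 2.

Definition mean_cost (beta : R -> bool -> R) (M : R -> R) (t : R) : R :=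
  M t * (2^-1 * beta t true ^+ 2 + kappa * (1 - p t)) +
  (1 - M t) * (2^-1 * beta t false ^+ 2 + kappa * p t).

(** This is value_rate plus the derivative of a M. *)
Definition hamiltonian (beta : R -> bool -> R) (M : R -> R) (t : R) : R :=
  value_rate t + ((drift s (a t) - kappa * q t) * M t + a t * net_flow s beta M t).

(** Minimize the cost over each of the two rates by completing the square,
    with the constraint that rates are nonnegative. The minimizer is
    best_control. *)
Lemma hamiltonian_le beta M t : 0 <= M t <= 1 ->
  0 <= beta t true -> 0 <= beta t false -> hamiltonian beta M t <= mean_cost beta M t.
Proof.
rewrite /hamiltonian /mean_cost /value_rate /net_flow /mass_one driftE.
move: (M t) (beta t true) (beta t false) => m b1 b0 /andP[m0 m1] b10 b00.
have [a0|a0] := leP 0 (a t).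
  rewrite ger0_norm//.
  have h0 : 0 <= (1 - m) * (b0 - a t) ^+ 2 by rewrite mulr_ge0 ?sqr_ge0// subr_ge0.
  have h1 : 0 <= m * (b1 * (b1 + 2 * a t)) by rewrite !mulr_ge0// addr_ge0// mulr_ge0.
  by lra.
rewrite ltr0_norm// expr0n/= mulr0.
have h0 : 0 <= (1 - m) * (b0 * (b0 - 2 * a t)).
  by rewrite mulr_ge0 ?subr_ge0// mulr_ge0// subr_ge0; move: a0 b00; lra.
have h1 : 0 <= m * (b1 + a t) ^+ 2 by rewrite mulr_ge0 ?sqr_ge0.
by lra.
Qed.

Lemma hamiltonian_best M t :
  hamiltonian (best_control a) M t = mean_cost (best_control a) M t.
Proof.
rewrite /hamiltonian /mean_cost /value_rate /net_flow /mass_one driftE /best_control.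
have [a0|a0] := leP 0 (a t).
  by rewrite ger0_norm// max_r ?oppr_le0//; field.
by rewrite ltr0_norm// max_l ?oppr_ge0 ?(ltW a0)//; field.
Qed.

Let ca : continuous a.
Proof. by move=> t; exact: is_derive_continuous (da t). Qed.

Let cq : continuous q.
Proof. by move=> t; exact: is_derive_continuous (dq t). Qed.

Let cp : continuous p.
Proof.
apply: continuous_mul; last exact: continuous_const.
by apply: continuous_add => //; exact: continuous_const.
Qed.

Let cdrift : continuous (fun t => drift s (a t) - kappa * q t).
Proof.
apply: continuous_sub; last exact: continuous_mulc.
apply: (@continuous_compose _ (drift s)) => // x.
exact: is_derive_continuous (derive_drift s x).
Qed.

Let cvalue : continuous value_rate.
Proof.
apply: continuous_sub; last first.
  apply: continuous_mulc; apply: continuous_sqr => t.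
  by apply: continuous_max; [exact: ca|exact: cst_continuous].
by apply: continuous_sub; exact: continuous_mulc.
Qed.

Definition value_integral (S : R) : R := \int[mu]_(t in `[0, S]) value_rate t.

Lemma integral_hamiltonian (S : R) (beta : R -> bool -> R) (M : R -> R) :
  0 <= S -> admissible beta ->
  (forall S : R, {within `[0, S], continuous M}) ->
  (forall t, 0 <= t -> M t = M 0 + \int[mu]_(u in `[0, t]) net_flow s beta M u) ->
  mu.-integrable `[0, S] (EFin \o hamiltonian beta M) /\
  \int[mu]_(t in `[0, S]) hamiltonian beta M t =
    value_integral S + (a S * M S - a 0 * M 0).
Proof.
move=> S0 ab cM fM.
have iv : mu.-integrable `[0, S] (EFin \o value_rate).
  by apply: within_integrable; exact: continuous_subspaceT.
have inf : mu.-integrable `[0, S] (EFin \o net_flow s beta M).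
  exact: integrable_net_flow.
have iw : mu.-integrable `[0, S] (EFin \o (fun t =>
    (drift s (a t) - kappa * q t) * M t + a t * net_flow s beta M t)).
  apply: integrable_add => //.
    apply: within_integrable => t; apply: cvgM; last exact: cM.
    exact: (continuous_subspaceT cdrift).
  by apply: integrable_within_mul => //; exact: continuous_subspaceT.
split; first exact: integrable_add.
rewrite /hamiltonian RintegralD//; congr (_ + _).
apply: (integration_by_parts_ac S0 (cM S) inf _ cdrift da).
by move=> t /andP[t0 _]; exact: fM.
Qed.

(** Integrate hamiltonian_le over [0, S]. The derivative of a M contributes
    at most 2 A, whatever the horizon S. *)
Lemma expected_cost (S : R) (beta : R -> bool -> R) {d : measure_display} {T : measurableType d}
    (P : probability T R) (Y : R -> T -> bool) : 0 <= S ->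
  admissible beta -> markov_chain P Y (fun t x => s + beta t x) (p 0) ->
  let K := (\int[P]_w \int[mu]_(t in `[0%R, S])
    (2^-1 * beta t (Y t w) ^+ 2 + kappa * running_cost (Y t w) (p t))%:E)%E in
  ((value_integral S - 2 * A)%:E <= K)%E /\
  (beta = best_control a -> (K <= (value_integral S + 2 * A)%:E)%E).
Proof.
move=> S0 ab mc; have [M [PM M01 cM fM]] := chain_law ab mc.
move=> K.
have p01 t : 0 <= p t <= 1 by exact: mass_one_itv.
have [bge0 bint] := ab.
have A0 : 0 <= A by rewrite (le_trans (normr_ge0 _) (aA 0)).
pose f t x := 2^-1 * beta t x ^+ 2 + kappa * running_cost x (p t).
have mf x : measurable_fun `[0, S] (f^~ x).
  apply: measurable_funD; apply: measurable_funM; try exact: measurable_cst.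
    apply: measurable_funX.
    by have /measurable_int/measurable_EFinP := bint S x S0.
  apply: measurable_funTS; apply: continuous_measurable_fun.
  case: x => //=; apply: continuous_sub => //; exact: continuous_const.
have f0 t x : 0 <= t <= S -> 0 <= f t x.
  move=> _; apply: addr_ge0; apply: mulr_ge0; rewrite ?sqr_ge0 ?(ltW kappa0)//.
  by have /andP[] := p01 t; case: x => //=; rewrite subr_ge0.
have KE : K = (\int[mu]_(t in `[0%R, S]) (mean_cost beta M t)%:E)%E.
  rewrite /K; case: mc => mY rY _ _ _.
  rewrite (expected_occupation P mY rY mf f0); apply: eq_integral => t.
  rewrite inE/= in_itv/= => /andP[t0 _]; have [-> ->] := PM t t0.
  by rewrite -!EFinM -EFinD /mean_cost /f /=; congr EFin; ring.
have [iH HE] := integral_hamiltonian S0 ab cM fM.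
have bnd : `|a S * M S - a 0 * M 0| <= 2 * A.
  have b t : 0 <= t -> `|a t * M t| <= A.
    move=> t0; have /andP[m0 m1] := M01 t t0.
    by rewrite normrM (ger0_norm m0) (le_trans _ (aA t))// ler_piMr.
  rewrite (le_trans (ler_normB _ _))// mulr2n mulrDl mul1r.
  by rewrite lerD// b.
move: bnd; rewrite ler_norml => /andP[lo up].
have IH : (\int[mu]_(t in `[0%R, S]) (hamiltonian beta M t)%:E =
   (value_integral S + (a S * M S - a 0 * M 0))%:E)%E.
  by rewrite EFin_Rintegral// HE.
split; last first.
  move=> be; rewrite KE.
  have -> : mean_cost beta M = hamiltonian beta M.
    by apply/funext => t; rewrite be hamiltonian_best.
  by rewrite IH lee_fin lerD2l.
apply: (@le_trans _ _ (value_integral S + (a S * M S - a 0 * M 0))%:E).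
  by rewrite lee_fin lerD2l.
rewrite -IH KE.
have mmc : measurable_fun `[0, S] (EFin \o mean_cost beta M).
  apply/measurable_EFinP.
  have mM : measurable_fun `[0, S] M by exact: subspace_continuous_measurable_fun.
  apply: measurable_funD; apply: measurable_funM => //.
  - exact: (mf true).
  - by apply: measurable_funB => //; exact: measurable_cst.
  - exact: (mf false).
have Hle t : `[0, S]%classic t -> hamiltonian beta M t <= mean_cost beta M t.
  by rewrite /= in_itv/= => /andP[t0 _]; apply: hamiltonian_le;
    [exact: M01|exact: bge0|exact: bge0].
have mc0 t : `[0, S]%classic t -> 0 <= mean_cost beta M t.
  move=> St; have := f0 t true; have := f0 t false.
  move: St; rewrite /= in_itv/= => /andP[t0 tS]; rewrite t0 tS => /(_ isT) h1 /(_ isT) h2.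
  have /andP[m0 m1] := M01 t t0.
  by rewrite addr_ge0// mulr_ge0// subr_ge0.
have [iC|nC] := pselect (mu.-integrable `[0, S] (EFin \o mean_cost beta M)).
  apply: le_integral => //; move=> t; rewrite inE => St; rewrite lee_fin; exact: Hle.
have [h|h] := ltP (\int[mu]_(t in `[0%R, S]) (mean_cost beta M t)%:E)%E +oo%E; last first.
  by apply: le_trans h; exact: leey.
exfalso; apply: nC; apply/integrableP; split=> //.
apply: le_lt_trans h; apply: ge0_le_integral => //.
- exact: measurableT_comp.
- by move=> t St /=; rewrite ger0_norm// mc0.
Qed.

Lemma limf_esup_le_near (f g : R -> \bar R) :
  (forall e : R, 0 < e -> \forall S \near +oo, (f S <= g S + e%:E)%E) ->
  (limf_esup f (pinfty_nbhs R) <= limf_esup g (pinfty_nbhs R))%E.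
Proof.
move=> fg; rewrite [leRHS]limf_esupE; apply: le_ereal_inf_tmp => _ [V FV <-].
apply/lee_addgt0Pr => e e0; rewrite limf_esupE.
have FW := filterI FV (fg e e0).
apply: (@le_trans _ _ (ereal_sup [set f x | x in V `&` [set S | (f S <= g S + e%:E)%E]])).
  by apply: ereal_inf_lbound; eexists; [exact: FW|].
apply: ge_ereal_sup => _ [S [VS fS] <-]; apply: le_trans fS _.
by rewrite leeD2r//; apply: ereal_sup_ubound; exists S.
Qed.

Lemma admissible_best : admissible (best_control a).
Proof.
split; first by move=> t x _; rewrite /best_control; case: x; rewrite le_max lexx orbT.
move=> S x _; apply: within_integrable; apply: continuous_subspaceT.
case: x => t.
  apply: (@continuous_max _ _ (fun t => - a t)); last exact: cst_continuous.
  by apply: cvgN; exact: ca.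
by apply: (@continuous_max _ _ a); [exact: ca|exact: cst_continuous].
Qed.

(** Over [0, S] the cost of best_control exceeds any other cost by at most 4
    A, which is negligible with respect to S. *)
Lemma best_cost_le (beta : R -> bool -> R)
    {d : measure_display} {T : measurableType d} (P : probability T R) (X : R -> T -> bool)
    {d' : measure_display} {T' : measurableType d'} (P' : probability T' R) (Y : R -> T' -> bool) :
  markov_chain P X (fun t x => s + best_control a t x) (p 0) ->
  admissible beta -> markov_chain P' Y (fun t x => s + beta t x) (p 0) ->
  (ergodic_cost kappa p (best_control a) P X <= ergodic_cost kappa p beta P' Y)%E.
Proof.
move=> cX ab cY; apply: limf_esup_le_near => e e0.
have A0 : 0 <= A by rewrite (le_trans (normr_ge0 _) (aA 0)).
near=> S.
have S0 : 0 < S by near: S; exact: nbhs_pinfty_gt.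
have Se : 4 * A / e <= S by near: S; apply: nbhs_pinfty_ge; exact: num_real.
have [lo _] := expected_cost (ltW S0) ab cY.
have [_ /(_ erefl) up] := expected_cost (ltW S0) admissible_best cX.
have Si : (0 <= (S^-1)%:E)%E by rewrite lee_fin invr_ge0 ltW.
apply: (le_trans (lee_wpmul2l Si up)).
apply: (@le_trans _ _ ((S^-1)%:E * (value_integral S - 2 * A)%:E + e%:E)%E); last first.
  by rewrite leeD2r// lee_wpmul2l.
rewrite -!EFinM -EFinD lee_fin -lerBlDl -mulrBr mulrC ler_pdivrMr//.
by move: Se; rewrite ler_pdivrMr//; lra.
Unshelve. all: by end_near. Qed.

End verification.

(** * Infinitely many equilibria *)

(** For |q| < 1 the second equation of the system recovers a from q and q',
    because a |-> a - |a| q is injective. *)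
Lemma flow_determines_control (R : realDomainType) (s q a b : R) : `|q| < 1 ->
  a - (2 * s + `|a|) * q = b - (2 * s + `|b|) * q -> a = b.
Proof.
move=> q1 e; apply/eqP; rewrite -subr_eq0 -normr_eq0; apply/eqP.
have ab : a - b = q * (`|a| - `|b|).
  apply/eqP; rewrite -subr_eq0; apply/eqP.
  move/eqP: e; rewrite -subr_eq0 => /eqP <-; ring.
have le : `|a - b| <= `|q| * `|a - b|.
  by rewrite [leLHS](congr1 Num.norm ab) normrM ler_wpM2l// ler_dist_dist.
have := normr_ge0 (a - b); move: le; rewrite -subr_ge0 -[X in _ - X]mul1r -mulrBl.
by move: `|a - b| => x; nra.
Qed.

Lemma orbit_equilibrium (R : realType) (sigma kappa A : R) (a q : R -> R) :
  0 < sigma -> 0 < kappa -> solves_system sigma kappa a q -> periodic_pair a q ->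
  (forall t, `|a t| <= A) -> (forall t, `|q t| <= 1) ->
  ergodic_nash_q sigma kappa q.
Proof.
move=> sg0 k0 sol [tau tau0 per] aA q1.
have s0 : 0 < sigma ^+ 2 by rewrite exprn_gt0.
have da (t : R) : is_derive t 1 a (drift (sigma ^+ 2) (a t) - kappa * q t) by case: (sol t).
have dq (t : R) : is_derive t 1 q (a t - (2 * sigma ^+ 2 + `|a t|) * q t) by case: (sol t).
have ca : continuous a by move=> t; exact: is_derive_continuous (da t).
split.
- by move=> t _; exact: mass_one_itv.
- by left; exists tau => // t _; have [_ ->] := per t.
have [d [T [P [X [mc lX]]]]] := two_state_chain_exists s0 aA q1 ca dq.
exists (best_control a), d, T, P, X; split=> //.
- exact: (admissible_best da).
- move=> beta d' T' P' Y ab cY.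
  exact: (best_cost_le k0 da dq aA q1 mc ab cY).
Qed.

Theorem proposition7p2 (R : realType) (sigma kappa : R) :
  0 < sigma -> 0 < kappa -> kappa_c sigma < kappa ->
  exists a q : nat -> R -> R,
    (forall n, rotating_equilibrium sigma kappa (a n) (q n)) /\
    (forall m n, m <> n -> ~ time_translate (q m) (q n)).
Proof.
move=> sg0 k0 kc; set s := sigma ^+ 2; pose K := Num.sqrt kappa.
have s0 : 0 < s by rewrite exprn_gt0.
have KK : K ^+ 2 = kappa by rewrite sqr_sqrtr// ltW.
have K0 : 0 < K by rewrite sqrtr_gt0.
have sK : 2 * s < K.
  have : (2 * s) ^+ 2 < K ^+ 2.
    by rewrite KK; apply: le_lt_trans kc; rewrite /kappa_c /s; lra.
  by rewrite ltr_pXn2r// nnegrE ltW// mulr_gt0.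
have w0 : 0 < well s K (cap s K).
  by rewrite mulr_gt0 ?cap_gt0 ?slack_gt0.
pose r n : R := well s K (cap s K) / n.+2%:R.
have r0 n : 0 < r n < well s K (cap s K).
  by rewrite divr_gt0//= ltr_pdivrMr// ltr_pMr// ltr1n.
have rinj : injective r.
  move=> m n /(mulfI (lt0r_neq0 w0))/invr_inj/eqP.
  by rewrite eqr_nat => /eqP [].
have /choice[a /choice[q H]] n := closed_orbit s0 sK (r0 n).
exists a, q; split=> [n|m n mn [u tu]].
  have [sol per nc [_ enc] bd] := H n; rewrite KK in sol.
  split=> //.
  apply: (@orbit_equilibrium _ _ _ (cap s K) (a n)) => //.
  - by move=> t; case: (bd t).
  - by move=> t; case: (bd t) => _ /ltW.
have [solm _ _ [em _] bm] := H m; have [soln _ _ [en _] _] := H n.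
(* A translate has the same q and q', hence the same a and the same energy;
   but the energies of the orbits are distinct. *)
have qe : q m 1 = q n (1 + u) by apply: tu.
have ae : a m 1 = a n (1 + u).
  have [_ q1] := bm 1.
  apply: (flow_determines_control (s := s) q1).
  have [_ dm] := solm 1; have [_ dn] := soln (1 + u).
  have sh := @derive_comp _ (q n) (fun t => t + u) 1 _ _ dn
    (derive_add (derive_id 1) (derive_const u 1)).
  have := derive_near _ sh => /(_ (q m)) sh'.
  have {}sh' : is_derive (1 : R) 1 (q m)
      ((a n (1 + u) - (2 * s + `|a n (1 + u)|) * q n (1 + u)) * (1 + 0)).
    apply: sh'; near=> t; rewrite tu//.
    by apply: ltW; near: t; exact: lt_nbhsr.
  have := @derive_val _ _ _ _ _ _ _ dm; rewrite (@derive_val _ _ _ _ _ _ _ sh').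
  by rewrite addr0 mulr1 qe => ->.
have := em 1; rewrite ae qe en => /eqP.
have /andP[rm _] := r0 m; have /andP[rn _] := r0 n.
by rewrite eqrXn2 ?(ltW rm) ?(ltW rn)// => /eqP/rinj/esym.
Unshelve. all: by end_near. Qed.
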